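(* Let $X$ be a connected closed surface with a fixed cellulation. (1) The evaluation map $[\mu]\mapsto\sum_{f}\mu(f)$ (sum over all faces $f$ of $X$) is a well-defined isomorphism $H^2(X;\mathbb{Z}_2)\cong\mathbb{Z}_2$; a flux $\mu\in C^2(X;\mathbb{Z}_2)$ admits a potential if and only if $[\mu]=0$ in $H^2(X;\mathbb{Z}_2)$, equivalently if and only if $\sum_f\mu(f)=0$. (2) Starting from a flux $\mu$, the set of fluxes reachable by finite sequences of edge toggles is the coset $\mu+B^2(X)$. Consequently the fluxes are partitioned into exactly $|H^2(X;\mathbb{Z}_2)|=2$ mutually unreachable sectors, namely the fluxes with even total parity and the fluxes with odd total parity, and any two fluxes of the same total parity are reachable from one another.
   Context: $C^k(X;\mathbb{Z}_2)$ is the set of functions from the $k$-cells of $X$ to $\mathbb{Z}_2=\mathbb{Z}/2\mathbb{Z}$, $\delta$ is the cellular coboundary, $(\delta A)(f)=\sum_{e\subset\partial f}A(e)$, and $B^2(X)=\delta(C^1(X;\mathbb{Z}_2))$. A closed surface is a compact 2-manifold without boundary (orientable or not). A flux is a 2-cochain $\mu\in C^2(X;\mathbb{Z}_2)$. A potential for $\mu$ is a 1-cochain $A\in C^1(X;\mathbb{Z}_2)$ with $\delta A=\mu$. An edge toggle at an edge $e$ is the move $\mu\mapsto\mu+\delta\epsilon_e$ on fluxes, where $\epsilon_e$ is the 1-cochain equal to $1$ on $e$ and $0$ on all other edges (it flips the values of $\mu$ on the two faces incident to $e$). The total parity of $\mu$ is $\sum_f\mu(f)\in\mathbb{Z}_2$,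 even if it is $0$ and odd if it is $1$. *)

(* Defs.v *)
From HB Require Import structures.
From mathcomp Require Import all_boot all_order all_algebra.
From mathcomp Require Import generic_quotient ring_quotient.
From mathcomp Require Import classical_sets functions reals topology.
From mathcomp Require Import normedtype trigo.

Set Implicit Arguments.
Unset Strict Implicit.
Unset Printing Implicit Defensive.

Import Order.TTheory GRing.Theory Num.Theory numFieldNormedType.Exports.
Local Open Scope ring_scope.

Section Surface.
Variable R : realType.
Local Open Scope classical_set_scope.

(* Every point has an open neighbourhood U homeomorphic (by phi, with inverse
   psi) to an open subset of the plane. *)
Definition locally_planar (X : topologicalType) :=
  forall x : X, exists (U : set X) (phi : X -> R * R) (psi : R * R -> X),
    [/\ open U /\ U x, open (phi @` U),
        {within U, continuous phi}, {within phi @` U, continuous psi}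
      & forall y, U y -> psi (phi y) = y].

(* Second countability is implied by compactness and local planarity. *)
Definition closed_surface (X : topologicalType) :=
  [/\ hausdorff_space X, compact [set: X] & locally_planar X].

(* In mathcomp the empty set is connected, hence the nonemptiness clause. *)
Definition connected_space (X : topologicalType) :=
  [set: X] !=set0 /\ connected [set: X].

Definition disc : set (R * R) := [set p | p.1 ^+ 2 + p.2 ^+ 2 <= 1].
Definition open_disc : set (R * R) := [set p | p.1 ^+ 2 + p.2 ^+ 2 < 1].
Definition circle : set (R * R) := [set p | p.1 ^+ 2 + p.2 ^+ 2 = 1].
Definition unit_itv : set R := [set t | 0 <= t <= 1].
Definition open_itv : set R := [set t | 0 < t < 1].

(* The point at parameter t in [0, 1] of the i-th of n equal arcs of the
   circle, listed counterclockwise. *)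
Definition arc_pt (n i : nat) (t : R) : R * R :=
  let a := 2 * pi * (i%:R + t) / n%:R in (cos a, sin a).

(* A cellulation is a finite CW structure of dimension at most 2, given by
   characteristic maps, in which the boundary of each face is a closed edge
   path.  No regularity is required: an edge may be a loop, and an edge may
   occur several times along the boundary of a face.  Since X is compact
   Hausdorff and the cells are finitely many, X automatically carries the
   CW topology. *)
Record cellulation (X : topologicalType) := Cellulation {
  vertex : finType;
  edge : finType;
  face : finType;
  vmap : vertex -> X;
  emap : edge -> R -> X;      (* relevant on [0, 1] *)
  fmap : face -> R * R -> X;  (* relevant on the closed disc *)
  (* boundary path of a face: (e, true) is e traversed forwards, (e, false)
     is e traversed backwards *)
  sides : face -> seq (edge * bool);
  emap_continuous : forall e, {within unit_itv, continuous (emap e)};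
  fmap_continuous : forall f, {within disc, continuous (fmap f)};
  emap_inj : forall e, set_inj open_itv (emap e);
  fmap_inj : forall f, set_inj open_disc (fmap f);
  open_cell : vertex + edge + face -> set X :=
    fun c => match c with
             | inl (inl v) => [set vmap v]
             | inl (inr e) => emap e @` open_itv
             | inr f => fmap f @` open_disc
             end;
  open_cell_disjoint : trivIset [set: vertex + edge + face] open_cell;
  open_cell_cover : \bigcup_c open_cell c = [set: X];
  emap0 : forall e, exists v, emap e 0 = vmap v;
  emap1 : forall e, exists v, emap e 1 = vmap v;
  fmap_side : forall f (i : 'I_(size (sides f))) (t : R), unit_itv t ->
    let: (e, b) := tnth (in_tuple (sides f)) i in
    fmap f (arc_pt (size (sides f)) i t) = emap e (if b then t else 1 - t);
  (* a face with no side has its whole boundary collapsed to a vertex, as in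
     the cellulation of the sphere with one vertex and one face *)
  fmap_noside : forall f, sides f = [::] ->
    exists v, forall p, circle p -> fmap f p = vmap v
}.

End Surface.

Section Cochains.
Variables (R : realType) (X : topologicalType) (K : cellulation R X).

Definition cochain1 := {ffun edge K -> 'Z_2}.
Definition flux := {ffun face K -> 'Z_2}.

HB.instance Definition _ := GRing.Zmodule.on cochain1.
HB.instance Definition _ := Finite.on cochain1.
HB.instance Definition _ := GRing.Zmodule.on flux.
HB.instance Definition _ := Finite.on flux.

(* The sum over the edges of the boundary of f is taken with multiplicity. *)
Definition delta (A : cochain1) : flux :=
  [ffun f => \sum_(s <- sides f) A s.1].

Definition potential (mu : flux) (A : cochain1) := delta A = mu.

Definition B2 : {pred flux} := fun mu => [exists A, delta A == mu].

Lemma deltaB (A B : cochain1) : delta (A - B) = delta A - delta B.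
Proof.
apply/ffunP => f; rewrite !ffunE -sumrB.
by apply: eq_bigr => s _; rewrite !ffunE.
Qed.

Fact B2_zmod_closed : zmod_closed B2.
Proof.
split; first by apply/existsP; exists 0; rewrite -(subrr 0) deltaB subrr.
move=> _ _ /existsP[A /eqP <-] /existsP[B /eqP <-].
by apply/existsP; exists (A - B); rewrite deltaB.
Qed.
HB.instance Definition _ := GRing.isZmodClosed.Build flux B2 B2_zmod_closed.

(* There are no 3-cells, so every 2-cochain is a cocycle and H^2 = C^2 / B^2. *)
Definition H2 := Quotient.quot B2.
HB.instance Definition _ := GRing.Zmodule.on H2.
HB.instance Definition _ :=
  Countable.copy H2 (can_type (@reprK flux (Quotient.quot B2))).
HB.instance Definition _ : isFinite H2 :=
  CanIsFinite (@reprK flux (Quotient.quot B2)).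

Definition cohomology_class (mu : flux) : H2 := (\pi_(Quotient.quot B2) mu)%qT.

Definition total_parity (mu : flux) : 'Z_2 := \sum_f mu f.

Definition edge_cochain (e : edge K) : cochain1 := [ffun e' => (e' == e)%:R].

Definition edge_toggle (e : edge K) (mu : flux) : flux :=
  mu + delta (edge_cochain e).

Definition toggle_step : rel flux :=
  [rel mu nu | [exists e, nu == edge_toggle e mu]].

Definition reachable : rel flux := connect toggle_step.

Definition even_fluxes : {set flux} := [set mu | total_parity mu == 0]%SET.
Definition odd_fluxes : {set flux} := [set mu | total_parity mu == 1]%SET.

(* For the equivalence relation [reachable], the set of its classes. *)
Definition sectors : {set {set flux}} :=
  equivalence_partition reachable [set: flux]%SET.

End Cochains.

Arguments B2 {R X} K _.
Arguments reachable {R X} K _ _.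

(* Main.v *)
(* The parity of a coboundary vanishes because exactly two face sides lie along
   each edge, and every flux of even parity is a coboundary because the graph of
   faces adjacent along edges is connected. Both facts come from the topology of
   the plane, through a winding number modulo 2: a nonvanishing planar map has
   trivial class when it has a continuous square root. On an annulus the classes
   form a group of order two generated by the identity, which has no root on
   circles.

   At the midpoint of an edge with n sides, X looks like n half discs glued
   along their diameters. If n <= 1, every nonvanishing map on the punctured
   neighbourhood has a root, and so would the identity of a small circle in a
   chart. If n >= 3, there are two maps on the punctured neighbourhood with
   independent classes. Hence n = 2. For the connectivity, the closed faces of
   a family stable under adjacency and those of its complement meet in vertices
   only, and not even there since the punctured disc of a chart is connected;
   as X is connected, one of the families is empty. *)
From HB Require Import structures.
From mathcomp Require Import all_boot all_order all_algebra.
From mathcomp Require Import ring lra.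
From mathcomp Require Import generic_quotient ring_quotient.
From mathcomp Require Import boolp classical_sets reals topology.
From mathcomp Require Import normedtype trigo realfun numfun.
Require Import Defs.

Set Implicit Arguments.
Unset Strict Implicit.
Unset Printing Implicit Defensive.

Import Order.TTheory GRing.Theory Num.Theory numFieldNormedType.Exports.
Local Open Scope ring_scope.
Local Open Scope classical_set_scope.

(** * Continuity relative to a subset *)

(** Characteristic maps are injective only on open cells and a boundary path may repeat an edge, so
    a face need not be embedded near its boundary. What remains is that [X] is Hausdorff and the
    closed cells are finitely many and compact: the characteristic maps are closed, which turns a
    statement near a point of [X] into statements near its preimages in the closed cells
    ([near_compact_image], [nbhs_cells]). Midpoints of edges are convenient since their preimages in
    the face discs are exactly the midpoints of the arcs along that edge. Roots are kept only as
    directions: [half s f] asks that the square of [s] be a positive multiple of [f]. Positive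
    factors then need no care, division becomes multiplication by the conjugate, and uniqueness of
    roots becomes a statement on the sign of a scalar product that cannot vanish. Two principles
    then suffice in the plane: a map with positive real part has a root, whence homotopy invariance
    over a compact set; and roots on two closed pieces glue when their signs agree on the
    overlap. *)

Definition cont_on (T U : topologicalType) (A : set T) (f : T -> U) :=
  forall x, A x -> f @ within A (nbhs x) --> f x.

Section ContOn.
Context {T U : topologicalType}.
Implicit Types (A B : set T).

Lemma cont_onP A (f : T -> U) : {within A, continuous f} <-> cont_on A f.
Proof. exact: subspace_continuousP. Qed.

Lemma cont_on_nearP A (f : T -> U) : cont_on A f <->
  forall x W, A x -> nbhs (f x) W -> \forall y \near x, A y -> W (f y).
Proof. by split => [cf x W Ax Wfx|cf x Ax W Wfx]; [exact: cf|exact: cf]. Qed.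

Lemma cont_on_near A (f : T -> U) x (W : set U) :
  cont_on A f -> A x -> nbhs (f x) W -> \forall y \near x, A y -> W (f y).
Proof. by move=> /cont_on_nearP cf; exact: cf. Qed.

End ContOn.

Section ContOnTheory.
Context {T U V : topologicalType}.
Implicit Types (A B : set T).

Lemma cont_on_sub A B (f : T -> U) : A `<=` B -> cont_on B f -> cont_on A f.
Proof.
move=> AB /cont_on_nearP cf; apply/cont_on_nearP => x W Ax Wfx.
by have := cf x W (AB _ Ax) Wfx; apply: filterS => y h Ay; apply/h/AB.
Qed.

Lemma cont_on_comp A (B : set U) (f : T -> U) (g : U -> V) :
  (forall x, A x -> B (f x)) -> cont_on A f -> cont_on B g ->
  cont_on A (g \o f).
Proof.
move=> AB cf /cont_on_nearP cg; apply/cont_on_nearP => x W Ax Wx.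
have /(cont_on_near cf Ax) := cg _ W (AB _ Ax) Wx.
by apply: filterS => y h Ay; apply: h => //; exact: AB.
Qed.

Lemma continuous_cont_on A (f : T -> U) : continuous f -> cont_on A f.
Proof.
move=> cf; apply/cont_on_nearP => x W Ax Wx.
have : nbhs x (f @^-1` W) := cf x W Wx.
by apply: filterS.
Qed.

Lemma cont_on_eq A (f g : T -> U) :
  (forall x, A x -> f x = g x) -> cont_on A f -> cont_on A g.
Proof.
move=> fg /cont_on_nearP cf; apply/cont_on_nearP => x W Ax.
rewrite -fg// => /(cf x W Ax).
by apply: filterS => y h Ay /=; rewrite -fg//; exact: h.
Qed.

Lemma cont_on_cst A (c : U) : cont_on A (fun=> c).
Proof. by apply: continuous_cont_on; exact: cst_continuous. Qed.

Lemma cont_on_pair A (f : T -> U) (g : T -> V) :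
  cont_on A f -> cont_on A g -> cont_on A (fun x => (f x, g x)).
Proof. by move=> cf cg x Ax; apply: cvg_pair; [exact: cf|exact: cg]. Qed.

(** Pasting lemma: at a point outside one of the closed pieces, that piece is absent from a whole
    neighbourhood and its condition is vacuous. *)
Lemma cont_on_closedU (P Q : set T) (f : T -> U) : closed P -> closed Q ->
  cont_on P f -> cont_on Q f -> cont_on (P `|` Q) f.
Proof.
move=> clP clQ cfP cfQ; apply/cont_on_nearP => x W PQx Wfx.
have aux (S : set T) : closed S -> cont_on S f ->
    \forall y \near x, S y -> W (f y).
  move=> clS cS; have [Sx|nSx] := pselect (S x); first exact: cont_on_near cS Sx Wfx.
  have : nbhs x (~` S) by apply: open_nbhs_nbhs; split => //; exact: closed_openC.
  by apply: filterS => y nSy /nSy.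
have := aux _ clQ cfQ; have := aux _ clP cfP.
by apply: filterS2 => y hP hQ [/hP|/hQ].
Qed.

End ContOnTheory.

Lemma cont_on_id {T : topologicalType} (A : set T) : cont_on A id.
Proof. by apply: continuous_cont_on => x; exact: cvg_id. Qed.

Lemma cont_on_proj1 {U V : topologicalType} (A : set (U * V)) : cont_on A fst.
Proof. by apply: continuous_cont_on => x; exact: cvg_fst. Qed.

Lemma cont_on_proj2 {U V : topologicalType} (A : set (U * V)) : cont_on A snd.
Proof. by apply: continuous_cont_on => x; exact: cvg_snd. Qed.

Lemma cont_on_fst {T U V : topologicalType} (A : set T) (f : T -> U * V) :
  cont_on A f -> cont_on A (fun x => (f x).1).
Proof.
move=> cf; by apply: (@cont_on_comp _ _ _ A setT f fst) => //; exact: cont_on_proj1.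
Qed.

Lemma cont_on_snd {T U V : topologicalType} (A : set T) (f : T -> U * V) :
  cont_on A f -> cont_on A (fun x => (f x).2).
Proof.
move=> cf; by apply: (@cont_on_comp _ _ _ A setT f snd) => //; exact: cont_on_proj2.
Qed.

Section RealContOn.
Context {R : realType} {T : topologicalType}.
Implicit Types (A : set T) (f g : T -> R).

Lemma cont_onD A f g :
  cont_on A f -> cont_on A g -> cont_on A (fun x => f x + g x).
Proof. by move=> cf cg x Ax; apply: cvgD; [exact: cf|exact: cg]. Qed.

Lemma cont_onN A f : cont_on A f -> cont_on A (fun x => - f x).
Proof. by move=> cf x Ax; apply: cvgN; exact: cf. Qed.

Lemma cont_onB A f g :
  cont_on A f -> cont_on A g -> cont_on A (fun x => f x - g x).
Proof. by move=> cf cg; apply: cont_onD => //; exact: cont_onN. Qed.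

Lemma cont_onM A f g :
  cont_on A f -> cont_on A g -> cont_on A (fun x => f x * g x).
Proof. by move=> cf cg x Ax; apply: cvgM; [exact: cf|exact: cg]. Qed.

Lemma cont_onX A f n : cont_on A f -> cont_on A (fun x => f x ^+ n).
Proof.
move=> cf; elim: n => [|n IH].
  under eq_fun do rewrite expr0; exact: cont_on_cst.
under eq_fun do rewrite exprS; exact: cont_onM.
Qed.

Lemma cont_on_sqrt A f : cont_on A f -> cont_on A (fun x => Num.sqrt (f x)).
Proof.
move=> cf; apply: (@cont_on_comp _ _ _ A setT f Num.sqrt) => //.
by apply: continuous_cont_on; exact: sqrt_continuous.
Qed.

Lemma cont_onV A f : (forall x, A x -> f x != 0) -> cont_on A f ->
  cont_on A (fun x => (f x)^-1).
Proof. by move=> f0 cf x Ax; apply: cvgV; [exact: f0|exact: cf]. Qed.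

End RealContOn.

Ltac cont_step :=
  lazymatch goal with
  | |- cont_on ?A (fun _ => ?c) => apply: cont_on_cst
  | |- cont_on ?A (fun x => x) => apply: cont_on_id
  | |- cont_on ?A (fun x => (@?f x, @?g x)) => apply: (@cont_on_pair _ _ _ A f g)
  | |- cont_on ?A (fun x => @?f x + @?g x) => apply: (@cont_onD _ _ A f g)
  | |- cont_on ?A (fun x => - @?f x) => apply: (@cont_onN _ _ A f)
  | |- cont_on ?A (fun x => @?f x * @?g x) => apply: (@cont_onM _ _ A f g)
  | |- cont_on ?A (fun x => @?f x ^+ ?n) => apply: (@cont_onX _ _ A f n)
  | |- cont_on ?A (fun x => Num.sqrt (@?f x)) => apply: (@cont_on_sqrt _ _ A f)
  | |- cont_on ?A fst => apply: cont_on_proj1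
  | |- cont_on ?A snd => apply: cont_on_proj2
  | |- cont_on ?A (fun x => x.1) => apply: cont_on_proj1
  | |- cont_on ?A (fun x => x.2) => apply: cont_on_proj2
  | |- cont_on ?A (fun x => (@?f x).1) => apply: (@cont_on_fst _ _ _ A f)
  | |- cont_on ?A (fun x => (@?f x).2) => apply: (@cont_on_snd _ _ _ A f)
  end.

Ltac cont_tac := repeat first [ assumption | cont_step; cbv beta ].

(** * Square roots of nonvanishing planar maps *)

Section Planar.
Context {R : realType}.
Implicit Types (p q s t f g : R * R) (k : R).

(** The plane is read as the complex numbers: [nsq] is the squared modulus and [cdot p q] the real
    part of [cmul p (cconj q)]. *)
Definition cmul p q : R * R := (p.1 * q.1 - p.2 * q.2, p.1 * q.2 + p.2 * q.1).
Definition cconj p : R * R := (p.1, - p.2).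
Definition cscale k p : R * R := (k * p.1, k * p.2).
Definition nsq p : R := p.1 ^+ 2 + p.2 ^+ 2.
Definition cdot p q : R := p.1 * q.1 + p.2 * q.2.

Lemma cmulC p q : cmul p q = cmul q p.
Proof. by congr (_, _); rewrite /=; ring. Qed.

Lemma nsq_ge0 p : 0 <= nsq p.
Proof. by rewrite addr_ge0 ?sqr_ge0. Qed.

Lemma nsq_gt0 p : (0 < nsq p) = (p != 0).
Proof.
rewrite lt_def nsq_ge0 andbT; congr (~~ _); case: p => a b; rewrite /nsq /=.
by rewrite paddr_eq0 ?sqr_ge0// !sqrf_eq0 -pair_eqE.
Qed.

Lemma nsq_mul p q : nsq (cmul p q) = nsq p * nsq q.
Proof. by rewrite /nsq /=; ring. Qed.

Lemma nsq_conj p : nsq (cconj p) = nsq p.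
Proof. by rewrite /nsq /= sqrrN. Qed.

Lemma nsq_scale k p : nsq (cscale k p) = k ^+ 2 * nsq p.
Proof. by rewrite /nsq /=; ring. Qed.

Lemma cmul_neq0 p q : p != 0 -> q != 0 -> cmul p q != 0.
Proof. by rewrite -!nsq_gt0 nsq_mul; exact: mulr_gt0. Qed.

Lemma cconj_neq0 p : p != 0 -> cconj p != 0.
Proof. by rewrite -!nsq_gt0 nsq_conj. Qed.

(* [s] points in the direction of a square root of [f] *)
Definition half s f : Prop :=
  s != 0 /\ exists2 c, 0 < c & cmul s s = cscale c f.

Lemma half_neq0 s f : half s f -> f != 0.
Proof.
case=> s0 [c c0 e]; have := cmul_neq0 s0 s0.
by rewrite e -!nsq_gt0 nsq_scale pmulr_rgt0// exprn_gt0.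
Qed.

Lemma half_mul s t f g : half s f -> half t g -> half (cmul s t) (cmul f g).
Proof.
move=> [s0 [c c0 es]] [t0 [d d0 et]]; split; first exact: cmul_neq0.
exists (c * d); first exact: mulr_gt0.
have -> : cmul (cmul s t) (cmul s t) = cmul (cmul s s) (cmul t t).
  by congr (_, _); rewrite /=; ring.
by rewrite es et; congr (_, _); rewrite /=; ring.
Qed.

Lemma half_scale k s f : 0 < k -> half s (cscale k f) <-> half s f.
Proof.
move=> k0; split=> -[s0 [c c0 e]]; split=> //.
  exists (c * k); first exact: mulr_gt0.
  by rewrite e; congr (_, _); rewrite /=; ring.
exists (c / k); first exact: divr_gt0.
by rewrite e; congr (_, _); rewrite /= mulrA divfK ?gt_eqF.
Qed.

Lemma half_conj s f : half s f -> half (cconj s) (cconj f).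
Proof.
move=> [s0 [c c0 [e1 e2]]]; split; first exact: cconj_neq0.
by exists c => //; congr (_, _); rewrite /= ?mulrN ?mulNr ?opprK -?opprD ?e2 ?e1.
Qed.

(** Dividing by [g] and multiplying by its conjugate differ by the positive factor [nsq g], which
    [half] ignores. *)
Lemma half_div s t f g : half s (cmul f g) -> half t g ->
  half (cmul s (cconj t)) f.
Proof.
move=> hs ht; have g0 := half_neq0 ht; rewrite -nsq_gt0 in g0.
have := half_mul hs (half_conj ht).
have -> : cmul (cmul f g) (cconj g) = cscale (nsq g) f.
  by congr (_, _); rewrite /nsq /=; ring.
by move/(half_scale _ _ g0).
Qed.

Lemma half_opp s f : half s f -> half (cscale (-1) s) f.
Proof.
move=> [s0 [c c0 e]]; split.
  by move: s0; rewrite -!nsq_gt0 /nsq /= !mulN1r !sqrrN.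
by exists c => //; rewrite -e; congr (_, _); rewrite /=; ring.
Qed.

(** The product [w] of [t] and the conjugate of [s] has a positive real square, hence is real and
    nonzero; its coordinates are the scalar product and the determinant of [s] and [t]. *)
Lemma half_uniq s t f : half s f -> half t f ->
  cdot s t != 0 /\ s.1 * t.2 = s.2 * t.1.
Proof.
move=> [s0 [c c0 es]] [t0 [d d0 et]]; have f0 := half_neq0 (conj s0 (ex_intro2 _ _ c c0 es)).
set w := cmul t (cconj s).
have ew : cmul w w = (c * d * nsq f, 0).
  have -> : cmul w w = cmul (cmul t t) (cconj (cmul s s)).
    by congr (_, _); rewrite /=; ring.
  by rewrite es et; congr (_, _); rewrite /nsq /=; ring.
have w1 : cdot s t = w.1 by rewrite /cdot /w /=; ring.
have w2 : w.2 = s.1 * t.2 - s.2 * t.1 by rewrite /w /=; ring.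
have e1 : w.1 * w.1 - w.2 * w.2 = c * d * nsq f := congr1 fst ew.
have e2 : w.1 * w.2 + w.2 * w.1 = 0 := congr1 snd ew.
have : 0 < c * d * nsq f by rewrite !mulr_gt0// nsq_gt0.
rewrite w1 -e1 => h; have w10 : w.1 != 0.
  by apply: contraTneq h => ->; rewrite mulr0 sub0r -leNgt oppr_le0 -expr2 sqr_ge0.
split=> //; apply/eqP; rewrite -subr_eq0 -w2.
have : w.1 * w.2 *+ 2 = 0 by rewrite mulr2n {2}(mulrC w.1) e2.
by move/eqP; rewrite mulrn_eq0 /= mulf_eq0 (negbTE w10).
Qed.

Lemma norm1_le p : `|p.1| <= Num.sqrt (nsq p).
Proof. by rewrite -sqrtr_sqr ler_sqrt ?nsq_ge0// lerDl sqr_ge0. Qed.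

Lemma sqrt_nsq_bounds p : - Num.sqrt (nsq p) <= p.1 <= Num.sqrt (nsq p).
Proof. by rewrite -ler_norml norm1_le. Qed.

(** [sqrt_right] bisects [p] and the positive axis: for [r] the modulus of [p], its square is
    [2 * (r + p.1)] times [p]. [sqrt_upper] is the half-angle formula without its factor [1 / 2], so
    its square is twice [p] in the closed upper half plane. For [p] in the lower one, [sqrt_lower]
    is applied to [cconj p]. *)
Definition sqrt_right p : R * R := (Num.sqrt (nsq p) + p.1, p.2).
Definition sqrt_upper p : R * R :=
  (Num.sqrt (Num.sqrt (nsq p) + p.1), Num.sqrt (Num.sqrt (nsq p) - p.1)).
Definition sqrt_lower p : R * R := cconj (sqrt_upper p).

Lemma half_right p : 0 < p.1 -> half (sqrt_right p) p.
Proof.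
move=> p0; have r0 : 0 < Num.sqrt (nsq p) + p.1 by rewrite ltr_wpDl// sqrtr_ge0.
split; first by rewrite -nsq_gt0 ltr_wpDr ?sqr_ge0 ?exprn_gt0.
exists (2 * (Num.sqrt (nsq p) + p.1)); first by rewrite mulr_gt0.
have e : Num.sqrt (nsq p) ^+ 2 = p.1 ^+ 2 + p.2 ^+ 2 by rewrite sqr_sqrtr// nsq_ge0.
by congr (_, _); rewrite /=; [move: e; set r := Num.sqrt _ => e|]; lra.
Qed.

Lemma half_upper p : p != 0 -> 0 <= p.2 -> half (sqrt_upper p) p.
Proof.
move=> p0 p2; have /andP[b1 b2] := sqrt_nsq_bounds p.
have e : Num.sqrt (nsq p) ^+ 2 = p.1 ^+ 2 + p.2 ^+ 2 by rewrite sqr_sqrtr// nsq_ge0.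
have r0 : 0 < Num.sqrt (nsq p) by rewrite sqrtr_gt0 nsq_gt0.
rewrite /sqrt_upper; move: e r0 b1 b2; set r := Num.sqrt (nsq p) => e r0 b1 b2.
have x0 : 0 <= r + p.1 by lra.
have y0 : 0 <= r - p.1 by lra.
split; first by rewrite -nsq_gt0 /nsq /= !sqr_sqrtr//; lra.
exists 2 => //; congr (_, _); rewrite /=.
  by rewrite -!expr2 !sqr_sqrtr//; lra.
have ab : Num.sqrt (r + p.1) * Num.sqrt (r - p.1) = p.2.
  rewrite -sqrtrM//; have -> : (r + p.1) * (r - p.1) = p.2 ^+ 2 by lra.
  by rewrite sqrtr_sqr ger0_norm.
by rewrite (mulrC (Num.sqrt (r - p.1))) ab; ring.
Qed.

Lemma half_lower p : p != 0 -> p.2 <= 0 -> half (sqrt_lower (cconj p)) p.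
Proof.
move=> p0 p2.
have -> : p = cconj (cconj p) by case: p {p0 p2} => a b; rewrite /cconj /= opprK.
rewrite {2}/cconj /= opprK; apply: half_conj.
by apply: half_upper; [exact: cconj_neq0|rewrite /= oppr_ge0].
Qed.

End Planar.

Section Roots.
Context {R : realType} {T : topologicalType}.
Implicit Types (A B : set T) (f g : T -> R * R).

Definition has_root A f := exists2 s : T -> R * R,
  cont_on A s & forall y, A y -> half (s y) (f y).

Lemma cont_on_cmul A f g :
  cont_on A f -> cont_on A g -> cont_on A (fun y => cmul (f y) (g y)).
Proof. by move=> cf cg; rewrite /cmul; cont_tac. Qed.

Lemma cont_on_cconj A f : cont_on A f -> cont_on A (fun y => cconj (f y)).
Proof. by move=> cf; rewrite /cconj; cont_tac. Qed.

Lemma cont_on_cscale A k f : cont_on A f -> cont_on A (fun y => cscale k (f y)).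
Proof. by move=> cf; rewrite /cscale; cont_tac. Qed.

Lemma cont_on_nsq A f : cont_on A f -> cont_on A (fun y => nsq (f y)).
Proof. by move=> cf; rewrite /nsq; cont_tac. Qed.

Lemma cont_on_cdot A f g :
  cont_on A f -> cont_on A g -> cont_on A (fun y => cdot (f y) (g y)).
Proof. by move=> cf cg; rewrite /cdot; cont_tac. Qed.

Lemma cont_on_sqrt_upper A f :
  cont_on A f -> cont_on A (fun y => sqrt_upper (f y)).
Proof. by move=> cf; rewrite /sqrt_upper /nsq; cont_tac. Qed.

Lemma has_root_sub A B f : A `<=` B -> has_root B f -> has_root A f.
Proof.
move=> AB [s cs hs]; exists s; first exact: cont_on_sub AB cs.
by move=> y /AB; exact: hs.
Qed.

Lemma has_root_eq A f g : (forall y, A y -> f y = g y) -> has_root A f -> has_root A g.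
Proof. by move=> fg [s cs hs]; exists s => // y Ay; rewrite -fg//; exact: hs. Qed.

Lemma has_root_mul A f g :
  has_root A f -> has_root A g -> has_root A (fun y => cmul (f y) (g y)).
Proof.
move=> [s cs hs] [t ct ht]; exists (fun y => cmul (s y) (t y)).
  exact: cont_on_cmul.
by move=> y Ay; apply: half_mul; [exact: hs|exact: ht].
Qed.

Lemma has_root_div A f g :
  has_root A (fun y => cmul (f y) (g y)) -> has_root A g -> has_root A f.
Proof.
move=> [s cs hs] [t ct ht]; exists (fun y => cmul (s y) (cconj (t y))).
  by apply: cont_on_cmul => //; exact: cont_on_cconj.
by move=> y Ay; apply: half_div (hs y Ay) (ht y Ay).
Qed.

Lemma has_root_cst A (c : R * R) : c != 0 -> has_root A (fun=> c).
Proof.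
move=> c0; have [c2|/ltW c2] := leP 0 c.2.
  by exists (fun=> sqrt_upper c) => [|y _]; [exact: cont_on_cst|exact: half_upper].
by exists (fun=> sqrt_lower (cconj c)) => [|y _]; [exact: cont_on_cst|exact: half_lower].
Qed.

Lemma has_root_right A f :
  cont_on A f -> (forall y, A y -> 0 < (f y).1) -> has_root A f.
Proof.
move=> cf f0; exists (fun y => sqrt_right (f y)).
  by rewrite /sqrt_right /nsq; cont_tac.
by move=> y Ay; apply: half_right; exact: f0.
Qed.

Lemma has_root_lower A f : cont_on A f ->
  (forall y, A y -> f y != 0 /\ (f y).2 <= 0) -> has_root A f.
Proof.
move=> cf f0; exists (fun y => sqrt_lower (cconj (f y))).
  by apply: cont_on_cconj; apply: cont_on_sqrt_upper; exact: cont_on_cconj.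
by move=> y /f0[? ?]; exact: half_lower.
Qed.

(** Congruence modulo squares: the product with the conjugate is the quotient of [f] by [g] up to
    the positive factor [nsq (g y)]. *)
Definition root_equiv A f g := has_root A (fun y => cmul (f y) (cconj (g y))).

Lemma has_root_scale A f (k : T -> R) : (forall y, A y -> 0 < k y) ->
  has_root A (fun y => cscale (k y) (f y)) -> has_root A f.
Proof.
by move=> k0 [s cs hs]; exists s => // y Ay; apply/(half_scale _ _ (k0 y Ay))/hs.
Qed.

Lemma root_equivC A f g : root_equiv A f g -> root_equiv A g f.
Proof.
move=> [s cs hs]; exists (fun y => cconj (s y)); first exact: cont_on_cconj.
move=> y Ay; have := half_conj (hs y Ay).
by congr half; congr (_, _); rewrite /=; ring.
Qed.

Lemma root_equiv_trans A f g h : (forall y, A y -> g y != 0) ->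
  root_equiv A f g -> root_equiv A g h -> root_equiv A f h.
Proof.
move=> g0 hfg hgh; apply: (@has_root_scale _ _ (fun y => nsq (g y))).
  by move=> y Ay; rewrite nsq_gt0; exact: g0.
apply: has_root_eq (has_root_mul hfg hgh) => y _.
by congr (_, _); rewrite /nsq /=; ring.
Qed.

Lemma root_equiv_root A f g : root_equiv A f g -> has_root A g -> has_root A f.
Proof.
move=> hfg [t ct ht]; apply: has_root_div hfg _; exists (fun y => cconj (t y)).
  exact: cont_on_cconj.
by move=> y Ay; apply: half_conj; exact: ht.
Qed.

End Roots.

Lemma has_root_comp (R : realType) (T U : topologicalType) (A : set T) (B : set U)
    (h : T -> U) (f : U -> R * R) :
  (forall x, A x -> B (h x)) -> cont_on A h -> has_root B f ->
  has_root A (f \o h).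
Proof.
move=> AB ch [s cs hs]; exists (s \o h); first exact: cont_on_comp ch cs.
by move=> y /AB; exact: hs.
Qed.

(** * Homotopy invariance, gluing, and the annulus *)

(** The class of [a] is open and closed in [A]. The interiors of [A x -> E a x] and of
    [A x -> ~ E a x] provide the ambient open and closed sets that [connected] asks for. *)
Lemma connected_equiv (T : topologicalType) (A : set T) (E : T -> T -> Prop) :
  connected A ->
  (forall a, A a -> E a a) ->
  (forall a b, A a -> A b -> E a b -> E b a) ->
  (forall a b c, A a -> A b -> A c -> E a b -> E b c -> E a c) ->
  (forall a, A a -> \forall b \near a, A b -> E a b) ->
  forall a b, A a -> A b -> E a b.
Proof.
move=> cA Er Es Et loc a b Aa Ab.
suff : [set x | A x /\ E a x] = A by move=> e; have [] : [set x | A x /\ E a x] b by rewrite e.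
apply: cA; first by exists a; split => //; exact: Er.
- exists (interior [set x | A x -> E a x]); first exact: open_interior.
  apply/seteqP; split => [x [Ax Eax]|x [Ax /interior_subset/(_ Ax)]] //.
  split=> //; apply: filterS (loc x Ax) => y h Ay; exact: Et Eax (h Ay).
- exists (~` interior [set x | A x -> ~ E a x]).
    by apply: open_closedC; exact: open_interior.
  apply/seteqP; split => [x [Ax Eax]|x [Ax nx]].
    by split=> // /interior_subset/(_ Ax).
  split=> //; apply: contrapT => nEax; apply: nx.
  apply: filterS (loc x Ax) => y h Ay Eay; apply: nEax.
  by apply: (Et _ y) => //; apply: Es => //; exact: h.
Qed.

Section Homotopy.
Context {R : realType}.

Lemma unit_itv_connected : connected (@unit_itv R).
Proof.
exact: (@segment_connected _ (0 : R) 1).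
Qed.

(** For [t] close to [a] the values [F a y] and [F t y] make an acute angle, so their quotient has
    positive real part and a root by [has_root_right]. Congruence is thus locally constant on the
    unit interval. *)
Lemma root_equiv_homotopy (T : topologicalType) (A : set T)
    (F : R -> T -> R * R) :
  compact A ->
  cont_on (A `*` (@unit_itv R)) (fun p => F p.2 p.1) ->
  (forall t y, 0 <= t <= 1 -> A y -> F t y != 0) ->
  root_equiv A (F 0) (F 1).
Proof.
move=> cptA cF F0.
have cFt t : 0 <= t <= 1 -> cont_on A (F t).
  move=> t01; apply: (@cont_on_comp _ _ _ A _ (fun y => (y, t)) (fun p => F p.2 p.1) _ _ cF).
    by [].
  by cont_tac.
have I0 : (@unit_itv R) (0 : R) by rewrite /= /unit_itv /= lexx ler01.
have I1 : (@unit_itv R) (1 : R) by rewrite /= /unit_itv /= lexx ler01.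
apply: (connected_equiv (A := (@unit_itv R)) (E := fun s t => root_equiv A (F s) (F t))) => //.
- exact: unit_itv_connected.
- move=> a a01.
  apply: has_root_right; first by apply: cont_on_cmul; [exact: cFt|apply: cont_on_cconj; exact: cFt].
  move=> y Ay; rewrite /= mulrN opprK -!expr2 -/(nsq (F a y)) nsq_gt0.
  exact: F0.
- by move=> a b _ _; exact: root_equivC.
- move=> a b c _ b01 _; apply: root_equiv_trans.
  by move=> y; exact: F0.
move=> a a01.
(* Compactness of [A] makes the neighbourhood of [a] uniform in [y]. *)
have : \forall t \near a, forall y, A y -> 0 <= t <= 1 -> 0 < cdot (F a y) (F t y).
  move/compact_near_coveringP/near_covering_withinP : cptA => cptA.
  apply: (cptA _ (nbhs a) (fun t y => 0 <= t <= 1 -> 0 < cdot (F a y) (F t y))) => y Ay.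
  have cG : cont_on (A `*` (@unit_itv R)) (fun p => cdot (F a p.1) (F p.2 p.1)).
    apply: cont_on_cdot => //.
    apply: (@cont_on_comp _ _ _ (A `*` (@unit_itv R)) A fst (F a)) => //; last exact: cFt.
      by move=> x [].
    exact: cont_on_proj1.
  have := @cont_on_near _ _ _ _ (y, a) [set x : R | 0 < x] cG.
  move=> /(_ (conj Ay _)) [].
  - by [].
  - by apply: lt_nbhsr; rewrite /cdot -!expr2 -/(nsq _) nsq_gt0; exact: F0.
  move=> [P Q] [/= nP nQ] PQ; exists (P, Q) => // -[y' t] /= PQyt Ay' t01.
  exact: (PQ (y', t)).
apply: filterS => t h t01; apply: has_root_right.
  by apply: cont_on_cmul; [|apply: cont_on_cconj]; exact: cFt.
by move=> y Ay; rewrite /= mulrN opprK; exact: h.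
Qed.

Definition lerp (t : R) (p q : R * R) : R * R :=
  ((1 - t) * p.1 + t * q.1, (1 - t) * p.2 + t * q.2).

Lemma lerp0 p q : lerp 0 p q = p.
Proof. by case: p => a b; rewrite /lerp /= subr0 !mul1r !mul0r !addr0. Qed.

Lemma lerp1 p q : lerp 1 p q = q.
Proof. by case: q => a b; rewrite /lerp /= subrr !mul0r !mul1r !add0r. Qed.

Lemma nsq_lerp t p q : 0 <= t <= 1 ->
  nsq (lerp t p q) <= (1 - t) * nsq p + t * nsq q.
Proof.
move=> /andP[t0 t1]; rewrite -subr_ge0.
have -> : (1 - t) * nsq p + t * nsq q - nsq (lerp t p q) =
  t * (1 - t) * ((p.1 - q.1) ^+ 2 + (p.2 - q.2) ^+ 2) by rewrite /nsq /=; ring.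
by rewrite mulr_ge0 ?addr_ge0 ?sqr_ge0// mulr_ge0// subr_ge0.
Qed.

(** Contracting [A] along segments to [o] makes [f] homotopic to a constant. The segments may leave
    [A] as long as they stay in [B]; this serves half annuli, which are not star-shaped. *)
Lemma has_root_star (A B : set (R * R)) (o : R * R) (f : R * R -> R * R) :
  compact A -> cont_on B f -> (forall p, B p -> f p != 0) ->
  (forall p t, A p -> 0 <= t <= 1 -> B (lerp t p o)) ->
  has_root A f.
Proof.
move=> cA cf f0 AB; have [->|/set0P[p0 Ap0]] := eqVneq A set0.
  by exists f => [x []|x []].
have Bo : B o by have := AB p0 1 Ap0; rewrite lerp1; apply; rewrite lexx ler01.
apply: (@root_equiv_root _ _ _ _ (fun=> f o)); last by apply: has_root_cst; exact: f0.
have -> : f = fun p => f (lerp 0 p o) by apply/funext => p; rewrite lerp0.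
rewrite -[X in root_equiv _ _ X](_ : (fun p => f (lerp 1 p o)) = _); last first.
  by apply/funext => p; rewrite lerp1 lerp0.
apply: (@root_equiv_homotopy _ A (fun t p => f (lerp t p o))) => //.
- apply: (@cont_on_comp _ _ _ _ B (fun p : (R * R) * R => lerp p.2 p.1 o) f) => //.
    by move=> -[p t] [/= Ap]; exact: AB.
  by rewrite /lerp; cont_tac.
- by move=> t p t01 Ap; apply/f0/AB.
Qed.

(** Two root directions of the same number are parallel, so their scalar product never vanishes and
    keeps its sign along a connected set. *)
Lemma half_sign_const (T : topologicalType) (A : set T) (s t f : T -> R * R) :
  connected A -> cont_on A s -> cont_on A t ->
  (forall y, A y -> half (s y) (f y)) -> (forall y, A y -> half (t y) (f y)) ->
  forall a b, A a -> A b -> (0 < cdot (s a) (t a)) = (0 < cdot (s b) (t b)).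
Proof.
move=> conA cs ct hs ht.
apply: (connected_equiv (A := A)
  (E := fun a b => (0 < cdot (s a) (t a)) = (0 < cdot (s b) (t b)))) => //.
  by move=> a b c _ _ _ -> ->.
move=> a Aa; have d0 := (half_uniq (hs _ Aa) (ht _ Aa)).1.
have cd := cont_on_cdot cs ct.
have [dneg|dpos] := ltP (cdot (s a) (t a)) 0.
  have := @cont_on_near _ _ _ _ a [set x : R | x < 0] cd Aa (lt_nbhsl dneg).
  by apply: filterS => y h /h dy; rewrite (lt_gtF dneg) (lt_gtF dy).
have {}dpos : 0 < cdot (s a) (t a) by rewrite lt_def d0.
have := @cont_on_near _ _ _ _ a [set x : R | 0 < x] cd Aa (lt_nbhsr dpos).
by apply: filterS => y h Ay; rewrite dpos; symmetry; exact: h.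
Qed.

(** A root is fixed by [half] only up to a positive factor; normalising makes two roots that point
    the same way equal, as gluing requires. *)
Definition cunit (p : R * R) := cscale (Num.sqrt (nsq p))^-1 p.

Lemma half_cunit s f : half s f -> half (cunit s) f.
Proof.
move=> [s0 [c c0 e]].
have r0 : 0 < (Num.sqrt (nsq s))^-1 by rewrite invr_gt0 sqrtr_gt0 nsq_gt0.
split; first by rewrite -nsq_gt0 nsq_scale mulr_gt0 ?nsq_gt0// exprn_gt0.
exists ((Num.sqrt (nsq s))^-1 ^+ 2 * c); first by rewrite mulr_gt0// exprn_gt0.
rewrite [LHS](_ : _ = cscale ((Num.sqrt (nsq s))^-1 ^+ 2) (cmul s s)).
  by rewrite e; congr (_, _); rewrite /= mulrA.
by congr (_, _); rewrite /=; ring.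
Qed.

Lemma cont_on_cunit (T : topologicalType) (A : set T) (s : T -> R * R) :
  cont_on A s -> (forall y, A y -> s y != 0) ->
  cont_on A (fun y => cunit (s y)).
Proof.
move=> cs s0.
have cr : cont_on A (fun y => (Num.sqrt (nsq (s y)))^-1).
  apply: cont_onV => [y Ay|]; first by rewrite sqrtr_eq0 -ltNge nsq_gt0 s0.
  by apply: cont_on_sqrt; exact: cont_on_nsq.
by rewrite /cunit /cscale; cont_tac.
Qed.

Lemma half_cunit_eq s t f : half s f -> half t f -> 0 < cdot s t ->
  cunit s = cunit t.
Proof.
move=> hs ht d0; have [_ cr] := half_uniq hs ht.
have s0 := hs.1; have t0 := ht.1; rewrite -!nsq_gt0 in s0 t0.
rewrite /cunit; set a := Num.sqrt (nsq s); set b := Num.sqrt (nsq t).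
have a0 : 0 < a by rewrite sqrtr_gt0.
have b0 : 0 < b by rewrite sqrtr_gt0.
have a2 : a ^+ 2 = nsq s by rewrite sqr_sqrtr// ltW.
have b2 : b ^+ 2 = nsq t by rewrite sqr_sqrtr// ltW.
(* Equality case of Cauchy-Schwarz: [nsq s * nsq t - cdot s t ^+ 2] is the square of the determinant
   of [s] and [t], which is zero. *)
have ab : a * b = cdot s t.
  apply/eqP; rewrite -(eqrXn2 (_ : 0 < 2)%N)//; [|by rewrite mulr_ge0 ?ltW|exact: ltW].
  rewrite exprMn a2 b2 -subr_eq0 (_ : _ - _ = (s.1 * t.2 - s.2 * t.1) ^+ 2).
    by rewrite cr subrr expr0n.
  by rewrite /nsq /cdot; ring.
have : (b * s.1 - a * t.1) ^+ 2 + (b * s.2 - a * t.2) ^+ 2 = 0.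
  transitivity (b ^+ 2 * nsq s + a ^+ 2 * nsq t - a * b * cdot s t *+ 2).
    by rewrite /nsq /cdot; ring.
  by rewrite -ab a2 b2 -a2 -b2; ring.
move/eqP; rewrite paddr_eq0 ?sqr_ge0// !sqrf_eq0 !subr_eq0 => /andP[/eqP e1 /eqP e2].
have aux x y : b * x = a * y -> a^-1 * x = b^-1 * y.
  move=> e; have an0 : a != 0 by rewrite gt_eqF.
  have bn0 : b != 0 by rewrite gt_eqF.
  have -> : x = a * y / b by rewrite -e mulrAC divff// mul1r.
  by field; rewrite an0 bn0.
by congr (_, _); exact: aux.
Qed.

Lemma has_root_glue (T : topologicalType) (P Q : set T) (s t f : T -> R * R) :
  closed P -> closed Q -> cont_on P s -> cont_on Q t ->
  (forall y, P y -> half (s y) (f y)) -> (forall y, Q y -> half (t y) (f y)) ->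
  (forall y, P y -> Q y -> 0 < cdot (s y) (t y)) ->
  has_root (P `|` Q) f.
Proof.
move=> clP clQ cs ct hs ht st.
pose u y := if pselect (P y) then cunit (s y) else cunit (t y).
have uP y : P y -> cunit (s y) = u y by rewrite /u; case: pselect.
have uQ y : Q y -> cunit (t y) = u y.
  rewrite /u; case: pselect => // Py Qy; apply/esym.
  exact: half_cunit_eq (hs _ Py) (ht _ Qy) (st _ Py Qy).
exists u.
  apply: cont_on_closedU => //.
    by apply: cont_on_eq uP _; apply: cont_on_cunit => // y /hs[].
  by apply: cont_on_eq uQ _; apply: cont_on_cunit => // y /ht[].
by move=> y [Py|Qy]; [rewrite -uP//|rewrite -uQ//]; apply: half_cunit; [exact: hs|exact: ht].
Qed.

(* Along the first path [f] turns from a positive to a negative real through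
   the upper half plane, along the second one through the lower half plane;
   a square root would thus be multiplied by [i] and by [- i]. *)
Lemma no_root_two_paths (T : topologicalType) (S : set T) (f : T -> R * R)
    (g h : R -> T) :
  cont_on S f -> (forall y, S y -> f y != 0) ->
  cont_on (@unit_itv R) g -> cont_on (@unit_itv R) h ->
  (forall t, 0 <= t <= 1 -> S (g t) /\ 0 <= (f (g t)).2) ->
  (forall t, 0 <= t <= 1 -> S (h t) /\ (f (h t)).2 <= 0) ->
  g 0 = h 0 -> g 1 = h 1 ->
  0 < (f (g 0)).1 -> (f (g 1)).1 < 0 ->
  ~ has_root S f.
Proof.
move=> cf f0 cg ch Sg Sh gh0 gh1 fp fq [s cs hs].
have I0 : (@unit_itv R) (0 : R) by rewrite /= /unit_itv /= lexx ler01.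
have I1 : (@unit_itv R) (1 : R) by rewrite /= /unit_itv /= lexx ler01.
have II (t : R) : (@unit_itv R) t -> 0 <= t <= 1 by [].
have cfg : cont_on (@unit_itv R) (f \o g).
  by apply: cont_on_comp cg cf => t /II /Sg[].
have cfh : cont_on (@unit_itv R) (f \o h).
  by apply: cont_on_comp ch cf => t /II /Sh[].
have csg : cont_on (@unit_itv R) (s \o g).
  by apply: cont_on_comp cg cs => t /II /Sg[].
have csh : cont_on (@unit_itv R) (s \o h).
  by apply: cont_on_comp ch cs => t /II /Sh[].
have e1 := @half_sign_const _ (@unit_itv R) (s \o g) (fun t => sqrt_upper (f (g t)))
  (f \o g) unit_itv_connected csg (cont_on_sqrt_upper cfg).
have e2 := @half_sign_const _ (@unit_itv R) (s \o h)
  (fun t => sqrt_lower (cconj (f (h t))))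
  (f \o h) unit_itv_connected csh
  (cont_on_cconj (cont_on_sqrt_upper (cont_on_cconj cfh))).
have {}e1 : (0 < cdot (s (g 0)) (sqrt_upper (f (g 0)))) =
            (0 < cdot (s (g 1)) (sqrt_upper (f (g 1)))).
  apply: e1 => // t /II /Sg[St ft]; first exact: hs.
  by apply: half_upper => //; exact: f0.
have {}e2 : (0 < cdot (s (h 0)) (sqrt_lower (cconj (f (h 0))))) =
            (0 < cdot (s (h 1)) (sqrt_lower (cconj (f (h 1))))).
  apply: e2 => // t /II /Sh[St ft]; first exact: hs.
  by apply: half_lower => //; exact: f0.
have real t : 0 <= t <= 1 -> g t = h t -> (f (g t)).2 = 0.
  move=> t01 ght; apply/eqP; rewrite eq_le (Sg _ t01).2 andbT ght.
  by rewrite (Sh _ t01).2.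
have r0 := real 0 I0 gh0; have r1 := real 1 I1 gh1.
move: e1 e2; rewrite -gh0 -gh1.
have hq : half (s (g 1)) (f (g 1)) by apply: hs; exact: (Sg 1 I1).1.
have fq0 : f (g 1) != 0 by apply: f0; exact: (Sg 1 I1).1.
have fq2 : 0 <= (f (g 1)).2 by rewrite r1.
have [+ _] := half_uniq hq (half_upper fq0 fq2).
(* At the start [f] is a positive real and its upper and lower roots coincide; at the end it is a
   negative real and they are opposite, so [s] cannot keep its sign relative to both. *)
rewrite /sqrt_lower /sqrt_upper /cconj /cdot /nsq /= r0 r1 oppr0 expr0n addr0 !sqrtr_sqr.
rewrite addr0 sqrtr_sqr (ltr0_norm fq) (gtr0_norm fp) addNr subrr !sqrtr0 !oppr0 !mulr0.
rewrite !add0r !addr0 mulrN => n0 ->; rewrite oppr_gt0.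
by case: ltgtP n0.
Qed.

End Homotopy.

Section PlaneSets.
Context {R : realType}.

Lemma closed_le_fun (T : topologicalType) (g : T -> R) c :
  cont_on setT g -> closed [set x | g x <= c].
Proof.
move=> cg; rewrite -openC openE => x /= /negP; rewrite -ltNge => cx.
have := @cont_on_near _ _ _ _ x [set y : R | c < y] cg Logic.I (lt_nbhsr cx).
by apply: filterS => y /(_ Logic.I) h; apply/negP; rewrite -ltNge.
Qed.

Lemma closed_ge_fun (T : topologicalType) (g : T -> R) c :
  cont_on setT g -> closed [set x | c <= g x].
Proof.
move=> cg; rewrite (_ : [set x | _] = [set x | - g x <= - c]).
  by apply: closed_le_fun; exact: cont_onN.
by apply/seteqP; split => x /=; rewrite lerN2.
Qed.

Lemma open_lt_fun (T : topologicalType) (g : T -> R) c :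
  cont_on setT g -> open [set x | g x < c].
Proof.
move=> cg; rewrite -closedC (_ : ~` _ = [set x | c <= g x]); first exact: closed_ge_fun.
by apply/seteqP; split => x /=; rewrite leNgt => /negP.
Qed.

Lemma compact_nsq_bounded (A : set (R * R)) b :
  closed A -> (forall p, A p -> nsq p <= b) -> compact A.
Proof.
move=> clA Ab; pose c := Num.sqrt b.
apply: (@subclosed_compact _ A (`[- c, c] `*` `[- c, c])) => //.
  by apply: compact_setX; exact: segment_compact.
move=> p /Ab pb; rewrite /= !in_itv /= -!ler_norml -!sqrtr_sqr.
have b0 := le_trans (nsq_ge0 p) pb.
by split; rewrite ler_sqrt//; apply: le_trans pb; rewrite /nsq ?lerDl ?lerDr sqr_ge0.
Qed.

(** The bounds are on [nsq], so [a] and [b] are squares of radii. *)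
Definition annulus (a b : R) : set (R * R) := [set p | a <= nsq p <= b].
Definition punctured_disc (b : R) : set (R * R) := [set p | p != 0 /\ nsq p <= b].

Lemma closed_annulus a b : closed (annulus a b).
Proof.
rewrite (_ : annulus a b = [set p | a <= nsq p] `&` [set p | nsq p <= b]).
  by apply: closedI; [apply: closed_ge_fun|apply: closed_le_fun]; rewrite /nsq; cont_tac.
by apply/seteqP; split => p /= => [/andP|] [] // *; exact/andP.
Qed.

Lemma compact_annulus a b : compact (annulus a b).
Proof.
apply: (@compact_nsq_bounded _ b); first exact: closed_annulus.
by move=> p /andP[].
Qed.

Lemma annulus_punctured a b : 0 < a -> annulus a b `<=` punctured_disc b.
Proof. by move=> a0 p /andP[ap pb]; split => //; rewrite -nsq_gt0 (lt_le_trans a0). Qed.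

(** The sign [sg] selects a half of the annulus, which is contracted to the top or bottom of the
    outer circle. The segments avoid the origin because for [t > 0] their second coordinate has the
    strict sign of [sg]. *)
Lemma root_annulus_half a b (sg : R) (f : R * R -> R * R) :
  0 < a -> a <= b -> sg ^+ 2 = 1 ->
  cont_on (punctured_disc b) f -> (forall p, punctured_disc b p -> f p != 0) ->
  has_root (annulus a b `&` [set p | 0 <= sg * p.2]) f.
Proof.
move=> a0 ab sg1 cf f0; have b0 : 0 < b by exact: lt_le_trans ab.
have sb0 : 0 < Num.sqrt b by rewrite sqrtr_gt0.
apply: (@has_root_star _ _ (punctured_disc b) (0, sg * Num.sqrt b)) => //.
  apply: compact_closedI; first exact: compact_annulus.
  by apply: closed_ge_fun; cont_tac.
move=> p t [/andP[ap pb] /= p2] t01; split; last first.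
  apply: le_trans (nsq_lerp _ _ t01) _.
  have -> : nsq (0, sg * Num.sqrt b) = b.
    by rewrite /nsq /= expr0n add0r exprMn sg1 mul1r sqr_sqrtr// ltW.
  have : (1 - t) * nsq p <= (1 - t) * b by rewrite ler_wpM2l// subr_ge0; case/andP: t01.
  lra.
have [->|t0] := eqVneq t 0; first by rewrite lerp0 -nsq_gt0 (lt_le_trans a0).
rewrite -nsq_gt0 ltr_wpDl ?sqr_ge0// exprn_even_gt0//=.
have : 0 < sg * ((1 - t) * p.2 + t * (sg * Num.sqrt b)).
  rewrite [X in 0 < X](_ : _ = (1 - t) * (sg * p.2) + sg ^+ 2 * (t * Num.sqrt b)); last by ring.
  rewrite sg1 mul1r; case/andP: t01 => t0' t1.
  apply: ltr_wpDl; first by rewrite mulr_ge0// subr_ge0.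
  by rewrite mulr_gt0// lt_def t0.
by apply: contraTneq => ->; rewrite mulr0 ltxx.
Qed.

(** The upper and lower halves carry roots [s] and [t] and meet in two segments of the horizontal
    axis, on each of which [cdot] of [s] and [t] has constant sign. If the two signs agree, the
    roots glue. If they differ, the upper and lower roots of the identity, equal on the positive
    axis and opposite on the negative one, repair the mismatch and yield a root of the product. *)
Lemma annulus_root_dichotomy a b (f : R * R -> R * R) :
  0 < a -> a <= b ->
  cont_on (punctured_disc b) f -> (forall p, punctured_disc b p -> f p != 0) ->
  has_root (annulus a b) f \/ has_root (annulus a b) (fun p => cmul p (f p)).
Proof.
move=> a0 ab cf f0.
set P := annulus a b `&` [set p | 0 <= p.2].
set Q := annulus a b `&` [set p | p.2 <= 0].
have PQ : annulus a b = P `|` Q.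
  by apply/seteqP; split => [p Ap|p [[]|[]]//]; have [|/ltW] := leP 0 p.2; [left|right].
have [s cs hs] : has_root P f.
  rewrite (_ : P = annulus a b `&` [set p | 0 <= 1 * p.2]).
    by apply: root_annulus_half; rewrite ?expr1n.
  by congr (_ `&` _); apply/funext => p /=; rewrite mul1r.
have [t ct ht] : has_root Q f.
  rewrite (_ : Q = annulus a b `&` [set p | 0 <= (-1) * p.2]).
    by apply: root_annulus_half; rewrite ?sqrrN ?expr1n.
  by congr (_ `&` _); apply/funext => p /=; rewrite mulN1r oppr_ge0.
have clP : closed P.
  by apply: closedI; [exact: closed_annulus|apply: closed_ge_fun; cont_tac].
have clQ : closed Q.
  by apply: closedI; [exact: closed_annulus|apply: closed_le_fun; cont_tac].
have axis x : (a <= x ^+ 2 <= b) -> P (x, 0) /\ Q (x, 0).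
  by move=> xab; split; split; rewrite /annulus //= /nsq /= expr0n addr0.
have sa0 : 0 < Num.sqrt a by rewrite sqrtr_gt0.
have b0 : 0 < b by exact: lt_le_trans ab.
have sab : Num.sqrt a <= Num.sqrt b by rewrite ler_sqrt// ltW.
have pos x : `[Num.sqrt a, Num.sqrt b]%classic x -> 0 < x /\ a <= x ^+ 2 <= b.
  rewrite /= in_itv /= => /andP[ax xb]; have x0 := lt_le_trans sa0 ax; split => //.
  rewrite -[X in X <= _ <= _](sqr_sqrtr (ltW a0)) -[X in _ <= _ <= X](sqr_sqrtr (ltW b0)).
  by rewrite !lerXn2r// nnegrE ltW// (lt_le_trans x0).
have conJ : connected (`[Num.sqrt a, Num.sqrt b]%classic : set R).
  exact: segment_connected.
(* [e] is [1] on the right-hand segment and [-1] on the left-hand one. *)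
have sign (e : R) : e ^+ 2 = 1 -> forall x y,
    `[Num.sqrt a, Num.sqrt b]%classic x -> `[Num.sqrt a, Num.sqrt b]%classic y ->
    (0 < cdot (s (e * x, 0)) (t (e * x, 0))) = (0 < cdot (s (e * y, 0)) (t (e * y, 0))).
  move=> e1 x y Jx Jy.
  have ex z : `[Num.sqrt a, Num.sqrt b]%classic z -> P (e * z, 0) /\ Q (e * z, 0).
    by move=> /pos[_ h]; apply: axis; rewrite exprMn e1 mul1r.
  have caxis : cont_on `[Num.sqrt a, Num.sqrt b]%classic (fun x : R => (e * x, 0 : R)).
    by cont_tac.
  apply: (@half_sign_const _ _ _ (fun x => s (e * x, 0)) (fun x => t (e * x, 0))
    (fun x => f (e * x, 0)) conJ _ _ _ _ x y Jx Jy).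
  - by apply: cont_on_comp caxis cs => z /ex[].
  - by apply: cont_on_comp caxis ct => z /ex[].
  - by move=> z /ex[/hs].
  - by move=> z /ex[_ /ht].
have PQaxis p : P p -> Q p -> exists e x : R, [/\ e = 1 \/ e = -1,
    `[Num.sqrt a, Num.sqrt b]%classic x & p = (e * x, 0)].
  case: p => x y [pab /= y0] [_ /= y0']; have {y0 y0'} y0 : y = 0 by apply/eqP; rewrite eq_le y0 y0'.
  move: pab; rewrite /annulus /= /nsq /= y0 expr0n addr0 => /andP[ax xb].
  have J : `[Num.sqrt a, Num.sqrt b]%classic `|x|.
    by rewrite /= in_itv /= -sqrtr_sqr !ler_sqrt ?sqr_ge0 ?ax ?xb// ltW.
  have [x0|/ltW x0] := leP 0 x.
    by exists 1, `|x|; split => //; [left|rewrite mul1r ger0_norm].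
  by exists (-1), `|x|; split => //; [right|rewrite mulN1r ler0_norm// opprK].
have Ja : `[Num.sqrt a, Num.sqrt b]%classic (Num.sqrt a) by rewrite /= in_itv /= lexx.
have dn0 (e : R) x : e ^+ 2 = 1 -> `[Num.sqrt a, Num.sqrt b]%classic x ->
    cdot (s (e * x, 0)) (t (e * x, 0)) != 0.
  move=> e1 /pos[_ xab]; have [Pe Qe] : P (e * x, 0) /\ Q (e * x, 0).
    by apply: axis; rewrite exprMn e1 mul1r.
  exact: (half_uniq (hs _ Pe) (ht _ Qe)).1.
have e1 : (1 : R) ^+ 2 = 1 by rewrite expr1n.
have eN1 : (-1 : R) ^+ 2 = 1 by rewrite sqrrN expr1n.
(* The opposite of [t] is also a root, so the sign on the right-hand segment may be taken
   positive. *)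
wlog d1 : t ct ht sign dn0 / 0 < cdot (s (1 * Num.sqrt a, 0)) (t (1 * Num.sqrt a, 0)).
  move=> wl; have [d0|d0|d0] := ltgtP 0 (cdot (s (1 * Num.sqrt a, 0)) (t (1 * Num.sqrt a, 0))).
  - exact: wl d0.
  - have dN p q : cdot p (cscale (-1) q) = - cdot p q by rewrite /cdot /=; ring.
    apply: (wl (fun p => cscale (-1) (t p))).
    + exact: cont_on_cscale.
    + by move=> y Qy; apply: half_opp; exact: ht.
    + move=> e ee x y Jx Jy; rewrite !dN !oppr_gt0.
      rewrite !ltNge !le_eqVlt ![0 == _]eq_sym (negbTE (dn0 e x ee Jx)).
      by rewrite (negbTE (dn0 e y ee Jy)) (sign e ee x y).
    + by move=> e x ee Jx; rewrite dN oppr_eq0; exact: dn0.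
    + by rewrite dN oppr_gt0.
  - by have := dn0 1 _ e1 Ja; rewrite -d0 eqxx.
have [d2|d2] := ltP 0 (cdot (s (-1 * Num.sqrt a, 0)) (t (-1 * Num.sqrt a, 0))).
  left; rewrite PQ; apply: (has_root_glue clP clQ cs ct hs ht) => p Pp Qp.
  have [e [x [ee Jx ->]]] := PQaxis p Pp Qp.
  case: ee => ->; first by rewrite (sign 1 e1 _ _ Jx Ja).
  by rewrite (sign _ eN1 _ _ Jx Ja).
right; rewrite PQ.
have pn0 p : annulus a b p -> p != 0 by move=> /(annulus_punctured a0)[].
apply: (@has_root_glue _ _ P Q (fun p => cmul (sqrt_upper p) (s p))
          (fun p => cmul (sqrt_lower (cconj p)) (t p))) => //.
- by apply: cont_on_cmul => //; apply: cont_on_sqrt_upper; exact: cont_on_id.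
- apply: cont_on_cmul => //; apply: cont_on_cconj; apply: cont_on_sqrt_upper.
  by apply: cont_on_cconj; exact: cont_on_id.
- move=> p Pp; apply: half_mul; last exact: hs.
  by case: Pp => Ap p2; apply: half_upper => //; exact: pn0.
- move=> p Qp; apply: half_mul; last exact: ht.
  by case: Qp => Ap p2; apply: half_lower => //; exact: pn0.
(* Real part of a product of two complex numbers whose imaginary parts are, up to sign, the
   determinants; the last determinant vanishes since [s] and [t] are parallel. *)
have cm p q p' q' : cdot (cmul p q) (cmul p' q') =
    cdot p p' * cdot q q' - (p.1 * p'.2 - p.2 * p'.1) * (q.1 * q'.2 - q.2 * q'.1).
  by rewrite /cdot /=; ring.
move=> p Pp Qp; have [e [x [ee Jx ep]]] := PQaxis p Pp Qp.
have [_ cr] := half_uniq (hs _ Pp) (ht _ Qp).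
rewrite cm cr subrr mulr0 subr0 {Pp Qp cr}ep.
have x0 := (pos _ Jx).1.
have kk : cdot (sqrt_upper (e * x, 0)) (sqrt_lower (cconj (e * x, 0))) = e * x *+ 2.
  rewrite /sqrt_lower /sqrt_upper /cconj /cdot /nsq /= oppr0 expr0n addr0 sqrtr_sqr.
  rewrite mulrN -!expr2 !sqr_sqrtr; first by ring.
    by rewrite subr_ge0 ler_norm.
  by rewrite addrC -lerBlDl sub0r -normrN ler_norm.
rewrite kk; case: ee => ee; rewrite ee.
  by rewrite mul1r mulr_gt0 ?mulrn_wgt0//; rewrite -[x]mul1r (sign 1 e1 _ _ Jx Ja).
rewrite mulN1r mulNrn mulNr oppr_gt0 nmulr_llt0 ?mulrn_wgt0//.
have := sign _ eN1 _ _ Jx Ja; have := dn0 _ _ eN1 Jx; rewrite [RHS]ltNge d2 mulN1r /=.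
by case: ltgtP.
Qed.

End PlaneSets.

(** * Maps from a compact set to a Hausdorff space *)

(** Such a map is closed: points near [y] have all their parameters near the fibre of [y]. A
    parameter outside the fibre is discarded by separating its image from [y]. *)
Lemma near_compact_image (T X : topologicalType) (G : set T) (q : T -> X)
    (y : X) (W : set X) :
  hausdorff_space X -> compact G -> cont_on G q ->
  (forall d, G d -> q d = y -> \forall d' \near d, G d' -> W (q d')) ->
  \forall y' \near y, forall d, G d -> q d = y' -> W y'.
Proof.
move=> hX cG cq loc.
move/compact_near_coveringP/near_covering_withinP : cG => cG.
apply: (cG _ (nbhs y) (fun y' d => q d = y' -> W y')) => d Gd.
have [qy|/eqP qy] := pselect (q d = y).
  exists ([set d' | G d' -> W (q d')], setT) => /=.
    by split; [exact: loc|exact: filterT].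
  by move=> [d' y'] /= [h _] Gd' <-; exact: h.
move: hX; rewrite open_hausdorff => /(_ _ _ qy) [[U V] /= [qU yV] [oU oV UV]].
rewrite !inE in qU yV.
exists ([set d' | G d' -> U (q d')], V) => /=.
  split; last exact: open_nbhs_nbhs.
  by apply: cont_on_near cq Gd _; exact: open_nbhs_nbhs.
move=> [d' y'] /= [h Vy'] Gd' qd'; have : (U `&` V) y' by split => //; rewrite -qd'; exact: h.
by rewrite (eqP UV).
Qed.

(** The left inverse [r] reduces the fibre of [q d0] to [d0], so only neighbourhoods of [d0] have to
    be tested. *)
Lemma cont_on_inverse (T X : topologicalType) (G : set T) (q : T -> X)
    (r : X -> T) :
  hausdorff_space X -> compact G -> cont_on G q ->
  (forall d, G d -> r (q d) = d) -> cont_on (q @` G) r.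
Proof.
move=> hX cG cq rq; apply/cont_on_nearP => y W [d0 Gd0 <-{y}] Wr.
have := @near_compact_image _ _ G q (q d0) [set y | W (r y)] hX cG cq.
move=> h; have {}h : \forall y' \near q d0, forall d, G d -> q d = y' -> W (r y').
  apply: h => d Gd e; rewrite rq// in Wr.
  have -> : d = d0 by rewrite -[LHS]rq// e rq.
  by apply: filterS Wr => d' Wd' Gd' /=; rewrite rq.
by apply: filterS h => y' h [d Gd e]; exact: h Gd e.
Qed.

Section PuncturedDisc.
Context {R : realType}.
Implicit Types (p q r : R * R) (E : R * R -> R * R -> Prop).

Lemma lerp_equiv (S : set (R * R)) E p q :
  (forall a, S a -> E a a) ->
  (forall a b, S a -> S b -> E a b -> E b a) ->
  (forall a b c, S a -> S b -> S c -> E a b -> E b c -> E a c) ->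
  (forall a, S a -> \forall b \near a, S b -> E a b) ->
  (forall t, 0 <= t <= 1 -> S (lerp t p q)) -> E p q.
Proof.
move=> Er Es Et loc Spq.
rewrite -(lerp0 p q) -[X in E _ X](lerp1 p q).
apply: (connected_equiv (A := @unit_itv R) (E := fun s t => E (lerp s p q) (lerp t p q))).
- exact: unit_itv_connected.
- by move=> a /Spq; exact: Er.
- by move=> a b /Spq ? /Spq; exact: Es.
- by move=> a b c /Spq ? /Spq ? /Spq; exact: Et.
- move=> a a01; have := loc _ (Spq a a01).
  have cl : cont_on (@unit_itv R) (fun t => lerp t p q) by rewrite /lerp; cont_tac.
  move/(cont_on_near cl a01); apply: filterS => b h b01.
  exact: h b01 (Spq b b01).
- by rewrite /unit_itv /= lexx ler01.
- by rewrite /unit_itv /= lexx ler01.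
Qed.

(** Connectedness of the punctured open disc, phrased for locally constant relations. Two points are
    joined by their segment unless they are aligned with the origin, in which case a perpendicular
    point serves as a relay. *)
Lemma punctured_disc_equiv b E :
  let S := [set p : R * R | p != 0 /\ nsq p < b] in
  (forall p, S p -> E p p) ->
  (forall p q, S p -> S q -> E p q -> E q p) ->
  (forall p q r, S p -> S q -> S r -> E p q -> E q r -> E p r) ->
  (forall p, S p -> \forall q \near p, S q -> E p q) ->
  forall p q, S p -> S q -> E p q.
Proof.
move=> S Er Es Et loc p q Sp Sq.
have ball x y t : S x -> S y -> 0 <= t <= 1 -> nsq (lerp t x y) < b.
  move=> [_ xb] [_ yb] t01; apply: le_lt_trans (nsq_lerp _ _ t01) _.
  case/andP: t01 => t0 t1; have [->|tn0] := eqVneq t 0.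
    by rewrite subr0 mul1r mul0r addr0.
  have : t * nsq y < t * b by rewrite ltr_pM2l// lt_def tn0.
  have : (1 - t) * nsq x <= (1 - t) * b by rewrite ler_wpM2l ?subr_ge0// ltW.
  lra.
(* Pythagoras keeps the segment between perpendicular vectors away from the origin. *)
have perp x y : S x -> S y -> cdot x y = 0 -> E x y.
  move=> Sx Sy xy; apply: (@lerp_equiv S) => // t t01; split; last exact: ball.
  rewrite -nsq_gt0 (_ : nsq _ = (1 - t) ^+ 2 * nsq x + t ^+ 2 * nsq y); last first.
    transitivity ((1 - t) ^+ 2 * nsq x + t ^+ 2 * nsq y + t * (1 - t) * cdot x y *+ 2).
      by rewrite /nsq /cdot /=; ring.
    by rewrite xy mulr0 mul0rn addr0.
  have [->|t0] := eqVneq t 0.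
    by rewrite subr0 expr1n mul1r expr0n mul0r addr0 nsq_gt0; case: Sx.
  apply: ltr_wpDl; first by rewrite mulr_ge0 ?sqr_ge0 ?nsq_ge0.
  by rewrite mulr_gt0 ?nsq_gt0 ?exprn_even_gt0//; case: Sy.
(* If the determinant vanishes, the quarter turn [r] of [p] is perpendicular to both points and has
   the norm of [p], hence stays in the disc. *)
have [cr|cr] := eqVneq (p.1 * q.2 - p.2 * q.1) 0.
  pose r : R * R := (- p.2, p.1).
  have nr : nsq r = nsq p by rewrite /nsq /= sqrrN addrC.
  have Sr : S r by split; rewrite -?nsq_gt0 nr ?nsq_gt0; case: Sp.
  apply: (Et p r q) => //; apply: perp => //; first by rewrite /cdot /=; ring.
  by rewrite -cr /cdot /=; ring.
apply: (@lerp_equiv S) => // t t01; split; last exact: ball.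
apply/eqP => l0; have : p.1 * (lerp t p q).2 - p.2 * (lerp t p q).1 = 0.
  by rewrite l0 /= !mulr0 subrr.
rewrite (_ : _ - _ = t * (p.1 * q.2 - p.2 * q.1)); last by rewrite /lerp /=; ring.
move/eqP; rewrite mulf_eq0 (negbTE cr) orbF => /eqP t0.
by move: l0; rewrite t0 lerp0 => p0; case: Sp; rewrite p0 eqxx.
Qed.

End PuncturedDisc.

(** * Arcs of the circle *)

Section Arcs.
Context {R : realType}.
Implicit Types (p q m : R * R) (t u : R).

Definition dist2 p m : R := (p.1 - m.1) ^+ 2 + (p.2 - m.2) ^+ 2.

Lemma dist2_ge0 p m : 0 <= dist2 p m.
Proof. by rewrite addr_ge0 ?sqr_ge0. Qed.

Lemma dist2_gt0 p m : p <> m -> 0 < dist2 p m.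
Proof.
move=> pm; rewrite lt_def dist2_ge0 andbT; apply/eqP => /eqP.
rewrite paddr_eq0 ?sqr_ge0// !sqrf_eq0 !subr_eq0 => /andP[/eqP e1 /eqP e2].
by apply: pm; case: p m e1 e2 => [? ?] [? ?] /= -> ->.
Qed.

Lemma dist2_lerp t p q m : 0 <= t <= 1 ->
  dist2 (lerp t p q) m <= (1 - t) * dist2 p m + t * dist2 q m.
Proof.
move=> /andP[t0 t1]; rewrite -subr_ge0.
have -> : (1 - t) * dist2 p m + t * dist2 q m - dist2 (lerp t p q) m =
  t * (1 - t) * dist2 p q by rewrite /dist2 /=; ring.
by rewrite mulr_ge0 ?dist2_ge0// mulr_ge0// subr_ge0.
Qed.

Lemma convex_comb_le t (x y z : R) : 0 <= t <= 1 -> x <= z -> y <= z ->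
  (1 - t) * x + t * y <= z.
Proof.
move=> /andP[t0 t1] xz yz.
have : (1 - t) * x <= (1 - t) * z by rewrite ler_wpM2l// subr_ge0.
have : t * y <= t * z by rewrite ler_wpM2l.
lra.
Qed.

Lemma convex_comb_lt t (x y z : R) : 0 <= t <= 1 -> x < z -> y < z ->
  (1 - t) * x + t * y < z.
Proof.
move=> t01 xz yz; apply: (@le_lt_trans _ _ (Num.max x y)).
  by apply: convex_comb_le => //; rewrite le_max lexx ?orbT.
by rewrite gt_max xz yz.
Qed.

Lemma cont_on_dist2 (T : topologicalType) (A : set T) (f : T -> R * R) m :
  cont_on A f -> cont_on A (fun x => dist2 (f x) m).
Proof. by move=> cf; rewrite /dist2; cont_tac. Qed.

Lemma near_dist2 m (r : R) : 0 < r -> \forall p \near m, dist2 p m < r.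
Proof.
move=> r0; apply: open_nbhs_nbhs; split.
  by apply: (@open_lt_fun _ _ (fun p => dist2 p m)); apply: cont_on_dist2; exact: cont_on_id.
by rewrite /= /dist2 !subrr !expr0n addr0.
Qed.

(** A product neighbourhood contains a box; halving its smaller radius leaves room for a closed
    Euclidean disc. *)
Lemma nbhs_dist2 m (W : set (R * R)) : nbhs m W ->
  exists2 r : R, 0 < r & forall p, dist2 p m <= r -> W p.
Proof.
move=> [[U V] [/= /nbhs_ballP[d d0 dU] /nbhs_ballP[e e0 eV]] UV].
rewrite /= in d0 e0.
pose c := Num.min d e / 2; have c0 : 0 < c by rewrite divr_gt0// lt_min d0.
have cd : c < d by rewrite ltr_pdivrMr// gt_min (_ : d < d * 2) ?ltr_pMr// ltr1n.
have ce : c < e by rewrite ltr_pdivrMr// gt_min (_ : e < e * 2) ?orbT// ltr_pMr// ltr1n.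
exists (c ^+ 2); first by rewrite exprn_gt0.
move=> p pm; have aux x : x ^+ 2 <= c ^+ 2 -> `|x| <= c.
  by move=> xc; rewrite -sqrtr_sqr -(ger0_norm (ltW c0)) -sqrtr_sqr ler_sqrt ?sqr_ge0.
suff : U p.1 /\ V p.2 by case: p {pm} => a b; exact: UV (a, b).
split; [apply: dU|apply: eV]; rewrite /ball /= distrC.
  by apply: le_lt_trans cd; apply: aux; apply: le_trans pm; rewrite lerDl sqr_ge0.
by apply: le_lt_trans ce; apply: aux; apply: le_trans pm; rewrite lerDr sqr_ge0.
Qed.

Lemma arc_pt_circle n i t : circle (arc_pt n i t : R * R).
Proof. exact: cos2Dsin2. Qed.

Lemma circle_disc : @circle R `<=` @disc R.
Proof. by move=> p; rewrite /circle /disc /= => ->. Qed.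

Lemma open_disc_disc : @open_disc R `<=` @disc R.
Proof. by move=> p /ltW. Qed.

Lemma disc_cases p : disc p -> open_disc p \/ circle p.
Proof.
by rewrite /disc /open_disc /circle /= le_eqVlt => /orP[/eqP|]; [right|left].
Qed.

Lemma cont_on_arc_pt n i (A : set R) : cont_on A (arc_pt n i).
Proof.
have ca : cont_on A (fun t => 2 * pi * (i%:R + t) / n%:R) by cont_tac.
apply: cont_on_pair.
  apply: (@cont_on_comp _ _ _ A setT _ cos _ ca) => //.
  by apply: continuous_cont_on; exact: continuous_cos.
apply: (@cont_on_comp _ _ _ A setT _ sin _ ca) => //.
by apply: continuous_cont_on; exact: continuous_sin.
Qed.

Lemma circle_angle p : circle p ->
  exists2 a : R, 0 <= a <= 2 * pi & p = (cos a, sin a).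
Proof.
rewrite /circle /= => c.
have p1 : -1 <= p.1 <= 1.
  by rewrite -ler_norml -sqrtr_sqr -sqrtr1 ler_sqrt// -c lerDl sqr_ge0.
have s1 : 1 - p.1 ^+ 2 = p.2 ^+ 2 by rewrite -c addrC addKr.
have a0 := acos_ge0 p1; have api := acos_lepi p1; have pi0 := pi_gt0 R.
have ca : cos (acos p.1) = p.1 by rewrite acosK// in_itv.
have [p2|p2] := leP 0 p.2.
  exists (acos p.1); first by rewrite a0 /=; lra.
  by rewrite ca sin_acos// s1 sqrtr_sqr ger0_norm//; case: p {c p1 s1 a0 api ca p2}.
exists (2 * pi - acos p.1); first by apply/andP; split; lra.
have -> : 2 * pi - acos p.1 = - acos p.1 + pi *+ 2 by ring.
rewrite cosD2pi sinD2pi cosN sinN ca sin_acos// s1 sqrtr_sqr ltr0_norm// opprK.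
by case: p {c p1 s1 a0 api ca p2}.
Qed.

Lemma circle_arc_pt n p : (0 < n)%N -> circle p ->
  exists (i : 'I_n) (t : R), 0 <= t <= 1 /\ p = arc_pt n i t.
Proof.
move=> n0 /circle_angle[a /andP[a0 a2] ->].
have n0' : (0 : R) < n%:R by rewrite ltr0n.
have pi0 := pi_gt0 R; have pi2 : (0 : R) < 2 * pi by rewrite mulr_gt0.
(* [u] is the angle in units of one arc: its integer part is the index and its fractional part the
   parameter. *)
pose u := a / (2 * pi) * n%:R.
have nn0 : (n%:R : R) != 0 by rewrite gt_eqF.
have au : 2 * pi * u / n%:R = a by rewrite /u mulrA [2 * pi * _]mulrC divfK ?(gt_eqF pi2)// mulfK.
have u0 : 0 <= u by rewrite mulr_ge0 ?divr_ge0// ltW.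
have un : u <= n%:R by rewrite ger_pMl// ler_pdivrMr// mul1r.
have [uln|nlu] := ltP u n%:R.
  have iu : (Num.truncn u < n)%N by rewrite truncn_lt_nat.
  exists (Ordinal iu), (u - (Num.truncn u)%:R); split.
    have /andP[h1 h2] := truncn_itv u0.
    by rewrite subr_ge0 h1 /= lerBlDl natr1 ltW.
  by rewrite /arc_pt /= [_ + (u - _)]addrC subrK au.
(* The angle [2 * pi] is the end of the last arc, with parameter [1]. *)
have iu : (n.-1 < n)%N by rewrite prednK.
exists (Ordinal iu), 1; rewrite ler01 lexx; split => //.
have -> : a = 2 * pi * (n.-1%:R + 1) / n%:R.
  by rewrite natr1 prednK// -au (le_anti (introT andP (conj un nlu))).
by [].
Qed.

(** The cosine of [b - a] is [1], so the sine of [(b - a) / 2] is zero, which is impossible strictly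
    between [0] and [pi]. *)
Lemma cos_sin_inj (a b : R) : 0 < a < 2 * pi -> 0 < b < 2 * pi ->
  cos a = cos b -> sin a = sin b -> a = b.
Proof.
wlog ab : a b / a <= b.
  move=> wl a0 b0 c s; have [ab|/ltW ba] := leP a b; first exact: wl.
  by symmetry; apply: wl.
move=> /andP[a0 a2] /andP[b0 b2] c s; apply/eqP; rewrite eq_le ab /= leNgt.
apply/negP => lt_ab.
have h : 0 < sin ((b - a) / 2) by apply: sin_gt0_pi; apply/andP; split; lra.
have : cos (b - a) = 1.
  by rewrite cosB c s -!expr2 cos2Dsin2.
have -> : b - a = ((b - a) / 2) *+ 2 by lra.
rewrite cos_mulr2n cos2sin2.
move: h; set x := sin _ => h e; have : 0 < x ^+ 2 by rewrite exprn_gt0.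
lra.
Qed.

(** Consecutive arcs share their ends, whence the strict parameters. The angle then determines
    [i + t], and [t] strictly inside the unit interval determines [i]. *)
Lemma arc_pt_inj n (i j : 'I_n) t u : 0 < t < 1 -> 0 < u < 1 ->
  arc_pt n i t = arc_pt n j u -> i = j /\ t = u.
Proof.
move=> t01 u01 [] ec es.
have n0 : (0 : R) < n%:R by rewrite ltr0n; case: n i {j ec es} => // -[].
have pi0 := pi_gt0 R.
have nn0 : (n%:R : R) != 0 by rewrite gt_eqF.
have pn0 : (pi : R) != 0 by rewrite gt_eqF.
have bnd (k : 'I_n) (v : R) : 0 < v < 1 -> 0 < 2 * pi * (k%:R + v) / n%:R < 2 * pi.
  move=> /andP[v0 v1]; apply/andP; split.
    by rewrite divr_gt0// !mulr_gt0// ltr_wpDl.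
  rewrite ltr_pdivrMr// ltr_pM2l ?mulr_gt0//.
  by apply: (@lt_le_trans _ _ (k%:R + 1)); rewrite ?ltrD2l// natr1 ler_nat.
have := cos_sin_inj (bnd i t t01) (bnd j u u01) ec es.
move/(congr1 (fun x => x * n%:R / (2 * pi))).
have simp (x : R) : 2 * pi * x / n%:R * n%:R / (2 * pi) = x.
  by rewrite divfK// [2 * pi * x]mulrC mulfK// gt_eqF// mulr_gt0.
rewrite !simp => e.
have ij : nat_of_ord i = j.
  have aux (k l : 'I_n) (v w : R) : 0 < v < 1 -> 0 < w < 1 -> k%:R + v = l%:R + w -> (k <= l)%N.
    move=> /andP[v0 v1] /andP[w0 w1] kl; rewrite -ltnS -(ltr_nat R) -natr1.
    lra.
  by apply/eqP; rewrite eqn_leq (aux _ _ _ _ t01 u01 e) (aux _ _ _ _ u01 t01 (esym e)).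
by split; [exact: val_inj|move: e; rewrite ij => /addrI].
Qed.

(** On the disc [dist2 p m] is at most [2 - 2 * cdot m p]. The open half plane [cdot m p < 1] thus
    removes from the disc the single point [m] and leaves a convex set. *)
Lemma circle_cdot_lt1 m p : circle m -> disc p -> p <> m -> cdot m p < 1.
Proof.
move=> cm dp /dist2_gt0; rewrite /circle /disc /dist2 /cdot /= in cm dp *.
move=> h; lra.
Qed.

Lemma disc_lerp t p q : 0 <= t <= 1 -> disc p -> disc q -> disc (lerp t p q).
Proof.
move=> t01 dp dq; apply: le_trans (nsq_lerp p q t01) _; exact: convex_comb_le.
Qed.

Lemma cdot_lerp t m p q :
  cdot m (lerp t p q) = (1 - t) * cdot m p + t * cdot m q.
Proof. by rewrite /cdot /=; ring. Qed.

Lemma has_root_convex (A B : set (R * R)) (f : R * R -> R * R) :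
  compact A -> A `<=` B ->
  (forall p q t, B p -> B q -> 0 <= t <= 1 -> B (lerp t p q)) ->
  cont_on B f -> (forall p, B p -> f p != 0) -> has_root A f.
Proof.
move=> cA AB convB cf f0; have [->|/set0P[o Ao]] := eqVneq A set0.
  by exists f => [x []|x []].
apply: (@has_root_star _ A B o) => // p t Ap t01.
by apply: convB => //; exact: AB.
Qed.

(** The upper and lower semicircles from [(r, 0)] to [(- r, 0)], parametrised linearly by the
    abscissa, are two paths as in [no_root_two_paths]. *)
Lemma no_root_circle (e : R) : 0 < e ->
  ~ has_root [set z : R * R | nsq z = e] id.
Proof.
move=> e0; pose r := Num.sqrt e; have r0 : 0 < r by rewrite sqrtr_gt0.
have r2 : r ^+ 2 = e by rewrite sqr_sqrtr// ltW.
have arc (sg : R) : sg ^+ 2 = 1 -> forall t, 0 <= t <= 1 ->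
    nsq (r * (1 - 2 * t), sg * (2 * r * Num.sqrt (t * (1 - t)))) = e.
  move=> sg1 t /andP[t0 t1]; rewrite /nsq /= [(sg * _) ^+ 2]exprMn sg1 mul1r !exprMn r2.
  rewrite sqr_sqrtr; first by ring.
  by rewrite mulr_ge0// subr_ge0.
apply: (@no_root_two_paths _ _ _ _
  (fun t => (r * (1 - 2 * t), 1 * (2 * r * Num.sqrt (t * (1 - t)))))
  (fun t => (r * (1 - 2 * t), (-1) * (2 * r * Num.sqrt (t * (1 - t)))))).
- exact: cont_on_id.
- by move=> y /= ye; rewrite -nsq_gt0 ye.
- by cont_tac.
- by cont_tac.
- move=> t t01; split; first by apply: arc; rewrite ?expr1n.
  by rewrite /= mul1r !mulr_ge0 ?sqrtr_ge0// ltW.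
- move=> t t01; split; first by apply: arc; rewrite ?sqrrN ?expr1n.
  by rewrite /= mulN1r oppr_le0 !mulr_ge0 ?sqrtr_ge0// ltW.
- by rewrite !mul0r sqrtr0 !mulr0.
- by rewrite !subrr !mulr0 sqrtr0 !mulr0.
- by rewrite /= mulr0 subr0 mulr1.
- rewrite /= mulr1 (_ : 1 - 2 = -1 :> R); last by ring.
  by rewrite mulrN1 oppr_lt0.
Qed.

End Arcs.

Section Charts.
Context {R : realType} {X : topologicalType}.

(** The chart is translated to send [x] to the origin; its open image then contains a closed disc,
    of squared radius [b], on which [psi] is a two-sided inverse. *)
Lemma centered_chart (x : X) : locally_planar R X ->
  exists (U : set X) (phi : X -> R * R) (psi : R * R -> X) (b : R),
    [/\ open U /\ U x, cont_on U phi /\ phi x = 0,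
        forall y, U y -> psi (phi y) = y,
        0 < b /\ (forall p, nsq p <= b -> U (psi p) /\ phi (psi p) = p)
      & cont_on [set p | nsq p <= b] psi].
Proof.
move=> /(_ x)[U [phi [psi [[oU Ux] oV /cont_onP cphi /cont_onP cpsi psiK]]]].
pose phi' y : R * R := ((phi y).1 - (phi x).1, (phi y).2 - (phi x).2).
pose sh (p : R * R) : R * R := (p.1 + (phi x).1, p.2 + (phi x).2).
have shK y : sh (phi' y) = phi y.
  by rewrite /sh /phi' /= !subrK; case: (phi y).
have : nbhs (phi x) (phi @` U).
  by apply: open_nbhs_nbhs; split => //; exists x.
move=> /nbhs_dist2[b b0 bV].
have shV p : nsq p <= b -> exists2 y, U y & phi y = sh p.
  by move=> pb; apply: bV; rewrite /dist2 /sh /= !addrK.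
exists U, phi', (psi \o sh), b; split => //.
- split; first by rewrite /phi'; cont_tac.
  by rewrite /phi' !subrr.
- by move=> y Uy /=; rewrite shK psiK.
- split=> // p /shV[y Uy e] /=; rewrite -e psiK//; split=> //.
  by rewrite /phi' e /sh /= !addrK; case: p {e}.
- apply: cont_on_comp cpsi.
    by move=> p /shV[y Uy e]; exists y.
  by rewrite /sh; cont_tac.
Qed.

End Charts.

(** * Local structure of a cellulation at the midpoint of an edge *)

Lemma plane_hausdorff (R : realType) : hausdorff_space (R * R)%type.
Proof.
rewrite open_hausdorff => p m /eqP /dist2_gt0 pm; pose r := dist2 p m / 4.
have r0 : 0 < r by rewrite divr_gt0.
exists ([set y | dist2 y p < r], [set y | dist2 y m < r]) => /=.
  by rewrite !inE /= /dist2 !subrr !expr0n addr0.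
split; try by apply: open_lt_fun; apply: cont_on_dist2; exact: cont_on_id.
apply/eqP; rewrite -subset0 => y [/= yp ym].
(* Parallelogram law: [dist2 p m <= 2 * dist2 y p + 2 * dist2 y m], and the right side is below
   [4 * r]. *)
have : 0 <= (2 * y.1 - p.1 - m.1) ^+ 2 + (2 * y.2 - p.2 - m.2) ^+ 2.
  by rewrite addr_ge0 ?sqr_ge0.
by move: yp ym; rewrite /r /dist2 => *; lra.
Qed.

Section ThinNeighbourhood.
Context {R : realType} {X : topologicalType}.

(* A point having such neighbourhoods [q @` D] is not a manifold point: every
   nonvanishing map on the punctured [D] has a square root, whereas the
   identity of a small circle around the origin of a chart has none. *)
Lemma no_thin_neighbourhood (x : X) (D : set (R * R)) (m : R * R) (r0 : R)
    (q : R * R -> X) :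
  locally_planar R X -> closed D -> D m -> q m = x -> 0 < r0 ->
  cont_on D q ->
  (forall p p', D p -> D p' -> dist2 p m <= r0 -> dist2 p' m <= r0 ->
     q p = q p' -> p = p') ->
  (forall r, 0 < r -> nbhs x (q @` (D `&` [set p | dist2 p m < r]))) ->
  (forall r' r (g : R * R -> R * R), 0 < r' -> r <= r0 ->
     cont_on (D `&` [set p | dist2 p m <= r]) g ->
     (forall p, D p -> dist2 p m <= r -> p <> m -> g p != 0) ->
     has_root (D `&` [set p | r' <= dist2 p m <= r]) g) ->
  False.
Proof.
move=> lpX clD Dm qm r00 cq qinj qnbhs qroot.
have [U [phi [psi [b [[oU Ux] [cphi phix] phiK [b0 psiK] cpsi]]]]] := centered_chart x lpX.
have [r [r_gt0 rr0 rU]] : exists r, [/\ 0 < r, r <= r0 & forall p, D p -> dist2 p m <= r -> U (q p)].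
  have : \forall p \near m, D p -> U (q p).
    by apply: cont_on_near cq Dm _; rewrite qm; exact: open_nbhs_nbhs.
  move=> /nbhs_dist2[r r1 h]; exists (Num.min r r0); rewrite lt_min r1 r00 ge_min lexx orbT.
  by split => // p Dp; rewrite le_min => /andP[/h + _]; exact.
have psi0 : psi 0 = x by rewrite -phix phiK.
have ball0 c : 0 < c -> nsq (0 : R * R) <= c by move=> /ltW; rewrite /nsq /= !expr0n addr0.
(* Since [q] covers a neighbourhood of [x], every chart point of squared norm at most [e] comes from
   a point of [D] close to [m]. *)
have [e [e0 eb eW]] : exists e, [/\ 0 < e, e <= b & forall p, nsq p <= e ->
    (q @` (D `&` [set p | dist2 p m < r])) (psi p)].
  have : \forall p \near (0 : R * R), nsq p <= b -> (q @` (D `&` [set p | dist2 p m < r])) (psi p).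
    by apply: cont_on_near cpsi (ball0 _ b0) _; rewrite psi0; exact: qnbhs.
  move=> /nbhs_dist2[e e1 h]; exists (Num.min e b); rewrite lt_min e1 b0 ge_min lexx orbT.
  split => // p; rewrite le_min => /andP[pe pb]; apply: h pb.
  by rewrite /dist2 /= !subr0.
pose Dr := D `&` [set p | dist2 p m <= r].
have cg : cont_on Dr (phi \o q).
  apply: cont_on_comp cphi; first by move=> p [Dp /rU]; exact.
  by apply: cont_on_sub cq => p [].
have Drm : Dr m.
  by split => //; rewrite /= /dist2 !subrr !expr0n addr0 ltW.
(* Points of [D] too close to [m] land strictly inside the circle [nsq z = e], which is therefore
   covered by the ring [A] alone. *)
have [r' r'0 r'e] : exists2 r', 0 < r' & forall p, Dr p -> dist2 p m <= r' -> nsq (phi (q p)) < e.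
  have cn := cont_on_nsq cg.
  have : \forall p \near m, Dr p -> [set y : R | y < e] (nsq (phi (q p))).
    apply: cont_on_near cn Drm _; apply: lt_nbhsl.
    by rewrite /= qm phix /nsq /= !expr0n addr0.
  by move=> /nbhs_dist2[r' r'0 h]; exists r' => // p Drp /h; exact.
pose A := D `&` [set p | r' <= dist2 p m <= r].
have ADr : A `<=` Dr by move=> p [Dp /andP[_ pr]].
have [s cs hs] : has_root A (phi \o q).
  apply: qroot => // p Dp pr pm; apply/eqP => /= phi0.
  have Uqp := rU _ Dp pr; apply: pm; apply: qinj => //.
  - exact: le_trans rr0.
  - by rewrite /dist2 !subrr !expr0n addr0 ltW.
  - by rewrite -(phiK _ Uqp) phi0 psi0 qm.
have cptA : compact A.
  have clr : closed [set p | r' <= dist2 p m <= r].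
    rewrite (_ : [set p | _] = [set p | r' <= dist2 p m] `&` [set p | dist2 p m <= r]).
      by apply: closedI; [apply: closed_ge_fun|apply: closed_le_fun];
        apply: cont_on_dist2; exact: cont_on_id.
    by apply/seteqP; split => p /= => [/andP|] [] // *; exact/andP.
  apply: (@compact_nsq_bounded _ _ (2 * r + 2 * nsq m)); first exact: closedI.
  move=> p [_ /andP[_ pr]].
  have : 0 <= (p.1 - 2 * m.1) ^+ 2 + (p.2 - 2 * m.2) ^+ 2 by rewrite addr_ge0 ?sqr_ge0.
  by move: pr; rewrite /dist2 /nsq => *; lra.
pose inv z := xget m [set p | A p /\ phi (q p) = z].
have invK p : A p -> inv ((phi \o q) p) = p.
  move=> Ap; rewrite /inv; case: xgetP => [p' -> [Ap' e1]|/(_ p)]; last by case.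
  have UA y : A y -> U (q y) by move=> /ADr[Dy]; exact: rU.
  have U1 := UA _ Ap.
  have U2 := UA _ Ap'.
  apply: qinj; [by case: Ap'|by case: Ap| | |].
  - by case: (ADr _ Ap') => _ /le_trans; exact.
  - by case: (ADr _ Ap) => _ /le_trans; exact.
  - by rewrite -(phiK _ U1) -(phiK _ U2) e1.
have cinv : cont_on ((phi \o q) @` A) inv.
  apply: (cont_on_inverse (@plane_hausdorff R) cptA _ invK).
  exact: cont_on_sub ADr cg.
apply: (@no_root_circle _ e e0).
have CA z : nsq z = e -> ((phi \o q) @` A) z.
  move=> ze; have /eW[p [Dp pr] qp] : nsq z <= e by rewrite ze.
  have pz : phi (q p) = z by rewrite qp; apply: (psiK z _).2; rewrite ze.
  exists p => //; split => //=; rewrite (ltW pr) andbT leNgt; apply/negP => /ltW pr'.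
  by have := r'e p (conj Dp (ltW pr)) pr'; rewrite pz ze ltxx.
apply: (@has_root_sub _ _ _ ((phi \o q) @` A)) => //.
(* The root on [A], carried over by the inverse of [phi \o q], is a root of the identity on an image
   containing the circle. *)
exists (s \o inv).
  apply: cont_on_comp cinv cs => _ [p Ap <-]; by rewrite invK.
by move=> _ [p Ap <-] /=; rewrite -/((phi \o q) p) invK//; exact: hs.
Qed.

End ThinNeighbourhood.

Section Cells.
Context {R : realType} {X : topologicalType} {K : cellulation R X}.
Implicit Types (v : vertex K) (e : edge K) (f : face K).

Definition side f (i : 'I_(size (sides f))) : edge K * bool :=
  tnth (in_tuple (sides f)) i.

Definition side_mid f (i : 'I_(size (sides f))) : R * R :=
  arc_pt (size (sides f)) i (1 / 2).

Lemma half_itv : 0 < (1 / 2 : R) < 1.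
Proof. by apply/andP; split; lra. Qed.

Lemma itv_oo_cc (t : R) : 0 < t < 1 -> 0 <= t <= 1.
Proof. by move=> /andP[/ltW -> /ltW ->]. Qed.

Lemma fmap_arc_pt f (i : 'I_(size (sides f))) (t : R) : 0 <= t <= 1 ->
  fmap f (arc_pt (size (sides f)) i t) =
  emap (side i).1 (if (side i).2 then t else 1 - t).
Proof. by move=> t01; have := fmap_side i t01; rewrite /side; case: (tnth _ _) => a b. Qed.

Lemma fmap_side_mid f (i : 'I_(size (sides f))) :
  fmap f (side_mid i) = emap (side i).1 (1 / 2).
Proof.
rewrite fmap_arc_pt; last exact/itv_oo_cc/half_itv.
by rewrite (_ : 1 - 1 / 2 = 1 / 2 :> R); [case: ifP|lra].
Qed.

Lemma compact_disc : compact (@disc R).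
Proof.
apply: (@compact_nsq_bounded _ _ 1) => //.
by apply: (@closed_le_fun _ _ (@nsq R)); rewrite /nsq; cont_tac.
Qed.

Lemma compact_unit_itv : compact (@unit_itv R).
Proof. exact: (@segment_compact R 0 1). Qed.

Lemma cont_on_emap e : cont_on (@unit_itv R) (emap e).
Proof. exact/cont_onP/emap_continuous. Qed.

Lemma cont_on_fmap f : cont_on (@disc R) (fmap f).
Proof. exact/cont_onP/fmap_continuous. Qed.

Lemma open_cell_inj (c d : vertex K + edge K + face K) y :
  open_cell c y -> open_cell d y -> c = d.
Proof. by move=> cy dy; apply: (@open_cell_disjoint R X K c d) => //; exists y. Qed.

Lemma open_cell_emap e (t : R) : 0 < t < 1 ->
  open_cell (inl (inr e)) (emap e t).
Proof. by move=> t01; exists t. Qed.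

Lemma open_cell_fmap f p : open_disc p -> open_cell (inr f) (fmap f p).
Proof. by move=> dp; exists p. Qed.

Lemma emap_cases e (t : R) : 0 <= t <= 1 ->
  (exists v, emap e t = vmap v) \/ 0 < t < 1.
Proof.
move=> /andP[]; rewrite le_eqVlt => /orP[/eqP <- _|t0].
  by left; exact: emap0.
rewrite le_eqVlt => /orP[/eqP ->|t1]; first by left; exact: emap1.
by right; rewrite t0 t1.
Qed.

Lemma vmap_neq_emap v e (t : R) : 0 < t < 1 -> vmap v <> emap e t.
Proof.
move=> /(open_cell_emap e) h ve; rewrite -ve in h.
have vv : open_cell (inl (inl v)) (vmap v) by [].
by have := open_cell_inj h vv.
Qed.

Lemma emap_eq e e' (t t' : R) : 0 < t < 1 -> 0 <= t' <= 1 ->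
  emap e t = emap e' t' -> e = e' /\ t = t'.
Proof.
move=> t01 t01' ee; have [[v ev]|t01''] := emap_cases e' t01'.
  by have := @vmap_neq_emap v e t t01; rewrite ee ev.
have h := open_cell_emap e t01; have h' := open_cell_emap e' t01''.
rewrite -ee in h'; have [e'e] := open_cell_inj h h'; rewrite -e'e in ee *; split=> //.
by apply: (@emap_inj R X K e t t' _ _ ee); rewrite inE.
Qed.

Lemma vmap_eq v v' : vmap v = vmap v' -> v = v'.
Proof.
move=> vv; have h : open_cell (inl (inl v)) (vmap v') by rewrite -vv.
have h' : open_cell (inl (inl v')) (vmap v') by [].
by have [] := open_cell_inj h h'.
Qed.

Lemma fmap_circle f p : circle p -> (exists v, fmap f p = vmap v) \/
  exists (i : 'I_(size (sides f))) (t : R),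
    0 < t < 1 /\ p = arc_pt (size (sides f)) i t.
Proof.
move=> cp; have [s0|sn0] := eqVneq (sides f) [::].
  by left; have [v vE] := fmap_noside s0; exists v; exact: vE.
have n0 : (0 < size (sides f))%N by rewrite lt0n size_eq0.
have [i [t [t01 pE]]] := circle_arc_pt n0 cp.
have [t01'|nt] := boolP (0 < t < 1); first by right; exists i, t.
left; rewrite pE fmap_arc_pt//.
have t01'' : 0 <= (if (side i).2 then t else 1 - t) <= 1.
  by case: ifP => // _; apply/andP; split; case/andP: t01 => *; lra.
have [//|h] := emap_cases (side i).1 t01''.
move: nt; suff -> : 0 < t < 1 by [].
by move: h; case: ifP => // _ /andP[? ?]; apply/andP; split; lra.
Qed.

Lemma fmap_skeleton f p : circle p ->
  (exists v, fmap f p = vmap v) \/ exists e (t : R), 0 < t < 1 /\ fmap f p = emap e t.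
Proof.
move=> /(fmap_circle f)[|[i [t [t01 ->]]]]; first by left.
right; exists (side i).1, (if (side i).2 then t else 1 - t); split; last first.
  by rewrite fmap_arc_pt// itv_oo_cc.
by case: ifP => // _; case/andP: t01 => *; apply/andP; split; lra.
Qed.

Lemma fmap_open_neq_vmap f p v : open_disc p -> fmap f p <> vmap v.
Proof.
move=> /(open_cell_fmap f) h fv; rewrite fv in h.
have vv : open_cell (inl (inl v)) (vmap v) by [].
by have := open_cell_inj h vv.
Qed.

Lemma fmap_open_neq_emap f p e (t : R) : open_disc p -> 0 <= t <= 1 ->
  fmap f p <> emap e t.
Proof.
move=> dp t01; have [[v ->]|t01'] := emap_cases e t01; first exact: fmap_open_neq_vmap.
move=> fe; have := open_cell_fmap f dp; rewrite fe => h.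
by have := open_cell_inj h (open_cell_emap e t01').
Qed.

(** A boundary point of a face goes to a vertex or an open edge, so [p'] must be interior as well;
    disjointness of open cells and [fmap_inj] conclude. *)
Lemma fmap_open_eq f f' p p' : open_disc p -> disc p' ->
  fmap f p = fmap f' p' -> f = f' /\ p = p'.
Proof.
move=> op /disc_cases[op'|cp'] ff; last first.
  have [[v fv]|[e [t [t01 fe]]]] := fmap_skeleton f' cp'.
    by have := @fmap_open_neq_vmap f p v op; rewrite ff fv.
  by have := @fmap_open_neq_emap f p e t op (itv_oo_cc t01); rewrite ff fe.
have h := open_cell_fmap f op; have h' := open_cell_fmap f' op'.
rewrite -ff in h'; have [e] := open_cell_inj h h'; rewrite -e in ff *; split=> //.
by apply: (@fmap_inj R X K f p p' _ _ ff); rewrite inE.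
Qed.

Lemma fmap_eq_emap f p e (t : R) : disc p -> 0 < t < 1 -> fmap f p = emap e t ->
  exists (i : 'I_(size (sides f))) (u : R),
    [/\ 0 < u < 1, p = arc_pt (size (sides f)) i u, (side i).1 = e &
        t = if (side i).2 then u else 1 - u].
Proof.
move=> /disc_cases[op|cp] t01 fe.
  by have := @fmap_open_neq_emap f p e t op (itv_oo_cc t01).
have [[v fv]|[i [u [u01 pE]]]] := fmap_circle f cp.
  by have := @vmap_neq_emap v e t t01; rewrite -fe fv.
exists i, u; move: fe; rewrite pE fmap_arc_pt ?itv_oo_cc// => /esym fe.
have [|-> ->] := emap_eq t01 _ fe; last by split.
by case: ifP; case/andP: u01 => *; apply/andP; split; lra.
Qed.

Lemma fmap_eq_mid f p e : disc p -> fmap f p = emap e (1 / 2) ->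
  exists i : 'I_(size (sides f)), (side i).1 = e /\ p = side_mid i.
Proof.
move=> dp /(fmap_eq_emap dp half_itv)[i [u [u01 pE <- ue]]].
exists i; split=> //; rewrite pE; congr arc_pt; move: ue; case: ifP => // _ ue.
lra.
Qed.

Lemma cell_cases y : [\/ exists v, y = vmap v,
  exists e (t : R), 0 < t < 1 /\ y = emap e t |
  exists f p, open_disc p /\ y = fmap f p].
Proof.
have : (\bigcup_c open_cell (c := K) c) y by rewrite open_cell_cover.
move=> [[[v|e]|f] _ /=].
- by move=> ->; apply: Or31; exists v.
- by move=> [t t01 <-]; apply: Or32; exists e, t.
- by move=> [p op <-]; apply: Or33; exists f, p.
Qed.

Hypothesis hX : hausdorff_space X.

(** The weak topology of the CW structure: finitely many closed cells, each a continuous image of a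
    compact set, so that [near_compact_image] applies cell by cell. *)
Lemma nbhs_cells y (W : set X) :
  (forall v, vmap v = y -> W y) ->
  (forall e (t : R), 0 <= t <= 1 -> emap e t = y ->
     \forall u \near t, 0 <= u <= 1 -> W (emap e u)) ->
  (forall f p, disc p -> fmap f p = y ->
     \forall q \near p, disc q -> W (fmap f q)) ->
  nbhs y W.
Proof.
move=> Wv We Wf.
have hv : \forall y' \near y, forall v, vmap v = y' -> W y'.
  apply: filter_forall => v.
  have := @near_compact_image _ _ [set (0 : R)] (fun=> vmap v) y W hX (@compact_set1 _ _).
  move=> /(_ (@cont_on_cst _ _ _ _)) h.
  have : \forall y' \near y, forall d : R, [set 0] d -> vmap v = y' -> W y'.
    by apply: h => d _ vy; apply: filterE => d' _; rewrite vy; exact: Wv vy.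
  by apply: filterS => y' /(_ 0 erefl).
have he : \forall y' \near y, forall e (t : R), unit_itv t -> emap e t = y' -> W y'.
  apply: filter_forall => e; apply: near_compact_image => //.
  - exact: compact_unit_itv.
  - exact: cont_on_emap.
  - by move=> t t01; exact: We.
have hf : \forall y' \near y, forall f p, disc p -> fmap f p = y' -> W y'.
  apply: filter_forall => f; apply: near_compact_image => //.
  - exact: compact_disc.
  - exact: cont_on_fmap.
  - by move=> p; exact: Wf.
near=> y'.
have hv' : forall v, vmap v = y' -> W y' by near: y'.
have he' : forall e (t : R), unit_itv t -> emap e t = y' -> W y' by near: y'.
have hf' : forall f p, disc p -> fmap f p = y' -> W y' by near: y'.
have [[v e]|[e [t [t01 ee]]]|[f [p [op ef]]]] := cell_cases y'.
- exact: hv' (esym e).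
- exact: he' (itv_oo_cc t01) (esym ee).
- exact: hf' (open_disc_disc op) (esym ef).
Unshelve. all: by end_near. Qed.

Lemma near_not_image (T : topologicalType) (G : set T) (q : T -> X) y :
  compact G -> cont_on G q -> (forall d, G d -> q d <> y) ->
  \forall y' \near y, forall d, G d -> q d <> y'.
Proof.
move=> cG cq qy; apply: (near_compact_image (W := set0)) => // d Gd qd.
by have := qy d Gd.
Qed.

Lemma near_not_vertex y (P : set (vertex K)) : (forall v, P v -> vmap v <> y) ->
  \forall y' \near y, forall v, P v -> vmap v <> y'.
Proof.
move=> vy; apply: filter_forall => v.
have [Pv|nPv] := pselect (P v); last by apply: filterE => y' /nPv.
have := @near_not_image _ [set (0 : R)] (fun=> vmap v) y (@compact_set1 _ _).
move=> /(_ (@cont_on_cst _ _ _ _) (fun _ _ => vy v Pv)).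
by apply: filterS => y' /(_ 0 erefl).
Qed.

(** The midpoint avoids finitely many compact sets: the vertices, the other closed edges, and the
    outer quarters of [e]. The bounds [1 / 4] and [3 / 4] are those of [edge_coordinate]. *)
Lemma near_edge_mid e : \forall y \near emap e (1 / 2),
  (forall v, vmap v <> y) /\
  (forall e' (t : R), 0 <= t <= 1 -> emap e' t = y -> e' = e /\ 1 / 4 <= t <= 3 / 4).
Proof.
have hv : \forall y \near emap e (1 / 2), forall v, setT v -> vmap v <> y.
  by apply: near_not_vertex => v _; exact: vmap_neq_emap half_itv.
have he : \forall y \near emap e (1 / 2), forall e', e' != e -> forall t, unit_itv t -> emap e' t <> y.
  apply: filter_forall => e'; have [->|ne] := eqVneq e' e; first exact: filterE.
  have := near_not_image compact_unit_itv (@cont_on_emap e').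
  move=> /(_ (emap e (1 / 2))) h.
  have {}h : \forall y \near emap e (1 / 2), forall t, unit_itv t -> emap e' t <> y.
    apply: h => t t01 /esym /(emap_eq half_itv t01)[ee _].
    by rewrite ee eqxx in ne.
  by apply: filterS h => y hy _.
have hs (t0 t1 : R) : 0 <= t0 -> t1 <= 1 -> 1 / 2 < t0 \/ t1 < 1 / 2 ->
    \forall y \near emap e (1 / 2), forall t, `[t0, t1]%classic t -> emap e t <> y.
  move=> t00 t11 te; have sub : `[t0, t1]%classic `<=` @unit_itv R.
    move=> t; rewrite /= in_itv /= => /andP[h1 h2]; rewrite /unit_itv /=.
    by rewrite (le_trans t00 h1) (le_trans h2 t11).
  apply: near_not_image; first exact: segment_compact.
    by apply: cont_on_sub sub (@cont_on_emap e).
  move=> t tt /esym /(emap_eq half_itv (sub t tt))[_ th].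
  by move: tt; rewrite /= in_itv /= => /andP[h1 h2]; case: te => *; lra.
have h1 : \forall y \near emap e (1 / 2), forall t, `[0, 1 / 4]%classic t -> emap e t <> y.
  by apply: hs; [|lra|right; lra].
have h2 : \forall y \near emap e (1 / 2), forall t, `[3 / 4, 1]%classic t -> emap e t <> y.
  by apply: hs; [lra| |left; lra].
near=> y; split.
  have h : forall v, setT v -> vmap v <> y by near: y.
  by move=> v; exact: h.
have k1 : forall t, `[0, 1 / 4]%classic t -> emap e t <> y by near: y.
have k2 : forall t, `[3 / 4, 1]%classic t -> emap e t <> y by near: y.
have k3 : forall e', e' != e -> forall t, unit_itv t -> emap e' t <> y by near: y.
move=> e' t t01 te; have [ee|ne] := eqVneq e' e; last by case: (k3 e' ne t t01 te).
rewrite {}ee in te *; split=> //; case/andP: t01 => t0 t1; rewrite !leNgt.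
apply/andP; split; apply/negP => /ltW tl.
  by apply: (k1 t _ te); rewrite /= in_itv /= t0.
by apply: (k2 t _ te); rewrite /= in_itv /= t1 andbT.
Unshelve. all: by end_near. Qed.

End Cells.

(** * Edges with no side or a single side *)

Section FewSides.
Context {R : realType} {X : topologicalType} {K : cellulation R X}.
Hypotheses (hX : hausdorff_space X) (lpX : locally_planar R X).
Implicit Types (v : vertex K) (e : edge K) (f : face K).

Lemma sqr_le_bound (x : R) : x ^+ 2 <= 1 / 9 -> -(1 / 2) < x < 1 / 2.
Proof.
move=> h; apply/andP; split; rewrite ltNge; apply/negP => hx.
  have : 0 <= (x + 1 / 2) * (x - 1 / 2) by rewrite mulr_le0//; lra.
  lra.
have : 0 <= (x + 1 / 2) * (x - 1 / 2) by rewrite mulr_ge0//; lra.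
lra.
Qed.

Lemma closed_dist2_ring (r' r : R) m : closed [set p : R * R | r' <= dist2 p m <= r].
Proof.
rewrite (_ : [set p | _] = [set p | r' <= dist2 p m] `&` [set p | dist2 p m <= r]).
  by apply: closedI; [apply: closed_ge_fun|apply: closed_le_fun];
    apply: cont_on_dist2; exact: cont_on_id.
by apply/seteqP; split => p /= => [/andP|] [] // *; exact/andP.
Qed.

Lemma compact_dist2_bounded (A : set (R * R)) m r :
  closed A -> (forall p, A p -> dist2 p m <= r) -> compact A.
Proof.
move=> clA Ar; apply: (@compact_nsq_bounded _ _ (2 * r + 2 * nsq m)) => // p /Ar pr.
have : 0 <= (p.1 - 2 * m.1) ^+ 2 + (p.2 - 2 * m.2) ^+ 2 by rewrite addr_ge0 ?sqr_ge0.
by move: pr; rewrite /dist2 /nsq => *; lra.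
Qed.

(** Otherwise the edge alone fills a neighbourhood of its midpoint, against [no_thin_neighbourhood]:
    a ring around the midpoint of a segment is made of two disjoint pieces, each inside a convex set
    avoiding the midpoint, so every map there has a root. *)
Lemma edge_has_side e : exists f (i : 'I_(size (sides f))), (side i).1 = e.
Proof.
apply: contrapT => nos.
(* The parameter interval, drawn in the plane to fit [no_thin_neighbourhood]. *)
pose D := [set p : R * R | 0 <= p.1 <= 1] `&` [set p : R * R | p.2 = 0].
pose m : R * R := (1 / 2, 0).
have d2E (p : R * R) : p.2 = 0 -> dist2 p m = (p.1 - 1 / 2) ^+ 2.
  by move=> p2; rewrite /dist2 /m /= p2 subrr expr0n addr0.
have clD : closed D.
  rewrite /D (_ : [set p : R * R | 0 <= p.1 <= 1] = [set p | 0 <= p.1] `&` [set p | p.1 <= 1]); last first.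
    by apply/seteqP; split => p /= => [/andP|] [] // *; exact/andP.
  rewrite (_ : [set p : R * R | p.2 = 0] = [set p | 0 <= p.2] `&` [set p | p.2 <= 0]); last first.
    by apply/seteqP; split => p /= => [->|[h1 h2]]; [|apply/eqP; rewrite eq_le h1 h2].
  by do ?apply: closedI; (apply: closed_ge_fun || apply: closed_le_fun); cont_tac.
have convD (p q : R * R) t : D p -> D q -> 0 <= t <= 1 -> D (lerp t p q).
  move=> [/andP[p0 p1] p2] [/andP[q0 q1] q2] t01.
  split; last by rewrite /= p2 q2 !mulr0 addr0.
  apply/andP; split; last exact: convex_comb_le.
  by case/andP: t01 => t0 t1; rewrite addr_ge0 ?mulr_ge0// subr_ge0.
(* The squared radius [1 / 9] keeps parameters within [1 / 3] of [1 / 2], hence interior to the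
   edge, where [emap_eq] gives injectivity. *)
apply: (@no_thin_neighbourhood _ _ (emap e (1 / 2)) D m (1 / 9) (fun p => emap e p.1)) => //.
- by split => //=; exact/itv_oo_cc/half_itv.
- lra.
- apply: (@cont_on_comp _ _ _ D (@unit_itv R) (fun p => p.1) (emap e)).
  + by move=> p [].
  + by cont_tac.
  + exact: cont_on_emap.
- move=> p p' [p1 p2] [p1' p2']; rewrite !d2E// => /sqr_le_bound b /sqr_le_bound b' ee.
  have p01 : 0 < p.1 < 1 by apply/andP; split; lra.
  have [_ e1] := emap_eq p01 p1' ee.
  by rewrite (surjective_pairing p) (surjective_pairing p') e1 p2 p2'.
- move=> r r0; apply: (nbhs_cells hX).
  + by move=> v; have := @vmap_neq_emap _ _ _ v e _ half_itv.
  + move=> e' t t01 /esym ee; have [<- <-] := emap_eq half_itv t01 ee.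
    have : \forall u \near (1 / 2 : R), setT u -> dist2 (u, 0) m < r.
      have cd : cont_on setT (fun u : R => dist2 (u, 0) m) by rewrite /dist2; cont_tac.
      apply: (@cont_on_near _ _ _ _ (1 / 2 : R) [set y : R | y < r] cd Logic.I).
      apply: lt_nbhsl.
      by rewrite d2E//= subrr expr0n.
    apply: filterS => u /(_ Logic.I) ur u01; exists (u, 0) => //.
  + move=> f p dp /(fmap_eq_mid dp)[i [ie _]]; exfalso; apply: nos.
    by exists f, i.
move=> r' r g r'0 rr0 cg g0.
pose A := D `&` [set p | r' <= dist2 p m <= r].
pose P := A `&` [set p | 1 / 2 <= p.1]; pose Q := A `&` [set p | p.1 <= 1 / 2].
have APQ : A = P `|` Q.
  apply/seteqP; split => [p Ap|p [[]|[]]//].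
  by have [|/ltW] := leP (1 / 2) p.1; [left|right].
have clA : closed A by apply: closedI => //; exact: closed_dist2_ring.
have clP : closed P by apply: closedI => //; apply: closed_ge_fun; cont_tac.
have clQ : closed Q by apply: closedI => //; apply: closed_le_fun; cont_tac.
have cptP : compact P by apply: (@compact_dist2_bounded _ m r) => // p [[_ /andP[]]].
have cptQ : compact Q by apply: (@compact_dist2_bounded _ m r) => // p [[_ /andP[]]].
have An p : A p -> p.1 <> 1 / 2.
  move=> [[_ p2] /andP[pr' _]] p1; move: pr'; rewrite d2E// p1 subrr expr0n leNgt.
  by rewrite r'0.
have half_root (sg : R) (S : set (R * R)) : compact S -> sg ^+ 2 = 1 -> S `<=` A ->
    (forall p, S p -> 0 < sg * (p.1 - 1 / 2)) -> has_root S g.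
  move=> cS sg1 SA Sg.
  pose B := D `&` [set p | dist2 p m <= r] `&` [set p | 0 < sg * (p.1 - 1 / 2)].
  apply: (@has_root_convex _ S B) => //.
  - by move=> p Sp; have [Dp /andP[_ pr]] := SA _ Sp; split => //; exact: Sg.
  - move=> p q t [[Dp pr] pg] [[Dq qr] qg] t01; split; first split.
    + exact: convD.
    + by apply: le_trans (dist2_lerp _ _ _ t01) _; exact: convex_comb_le.
    + rewrite /= -oppr_lt0.
      rewrite (_ : - _ = (1 - t) * (- (sg * (p.1 - 1 / 2))) + t * (- (sg * (q.1 - 1 / 2)))); last by ring.
      by apply: convex_comb_lt => //; rewrite oppr_lt0.
  - by apply: cont_on_sub cg => p [].
  - move=> p [[Dp pr] /= pg]; apply: g0 => // pm; move: pg.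
    by rewrite pm /m /= subrr mulr0 ltxx.
rewrite -/A APQ.
have [s cs hs] : has_root P g.
  apply: (half_root 1); rewrite ?expr1n//; first by move=> p [].
  move=> p [Ap /= p1].
  by rewrite mul1r subr_gt0 lt_def p1 andbT; exact/eqP/An.
have [u cu hu] : has_root Q g.
  apply: (half_root (-1)); rewrite ?sqrrN ?expr1n//; first by move=> p [].
  move=> p [Ap /= p1].
  by rewrite mulN1r opprB subr_gt0 lt_def p1 andbT eq_sym; exact/eqP/An.
(* The two pieces are disjoint, so the sign condition is vacuous. *)
apply: (has_root_glue clP clQ cs cu hs hu) => p [Ap /= p1] [_ /= p1'].
by case: (An p Ap); apply/eqP; rewrite eq_le p1 p1'.
Qed.

(** If [i] were the only side, the disc of [f] near [side_mid i] would parametrise a neighbourhood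
    of the midpoint injectively. Without this boundary point it is still convex, so
    [no_thin_neighbourhood] applies. *)
Lemma edge_second_side f (i : 'I_(size (sides f))) :
  exists f' (i' : 'I_(size (sides f'))), (side i').1 = (side i).1 /\
    existT (fun f => 'I_(size (sides f))) f' i' <>
    existT (fun f => 'I_(size (sides f))) f i.
Proof.
apply: contrapT => nos.
pose e := (side i).1; pose m := side_mid i.
have uniqi f' (i' : 'I_(size (sides f'))) : (side i').1 = e ->
    existT (fun f => 'I_(size (sides f))) f' i' = existT (fun f => 'I_(size (sides f))) f i.
  by move=> ie; apply: contrapT => ni; apply: nos; exists f', i'.
have uniqif (i' : 'I_(size (sides f))) : (side i').1 = e -> i' = i.
  by move=> /uniqi h; apply: eq_from_Tagged h.
have cm : circle m by exact: arc_pt_circle.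
have dm : disc m by exact: circle_disc.
have fm : fmap f m = emap e (1 / 2) by exact: fmap_side_mid.
have : \forall p \near m, disc p ->
    (forall v, vmap v <> fmap f p) /\
    (forall e' (t : R), 0 <= t <= 1 -> emap e' t = fmap f p -> e' = e /\ 1 / 4 <= t <= 3 / 4).
  apply: (@cont_on_near _ _ _ _ m [set y : X | (forall v, vmap v <> y) /\
    (forall e' (t : R), 0 <= t <= 1 -> emap e' t = y -> e' = e /\ 1 / 4 <= t <= 3 / 4)]
    (@cont_on_fmap _ _ _ f) dm); rewrite fm.
  exact: (near_edge_mid hX).
(* Within squared distance [r0] of [m], boundary points go to no vertex and to no edge but [e],
   hence lie on the arc of [i]. *)
move=> /nbhs_dist2[r0 r00 near_m].
apply: (@no_thin_neighbourhood _ _ (emap e (1 / 2)) (@disc R) m r0 (fmap f)) => //.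
- by apply: compact_closed; [exact: plane_hausdorff|exact: compact_disc].
- exact: cont_on_fmap.
- move=> p p' dp dp' pr pr' ff.
  have [op|cp] := disc_cases dp; first by have [] := fmap_open_eq op dp' ff.
  have [op'|cp'] := disc_cases dp'.
    by have [_ ->] := fmap_open_eq op' dp (esym ff).
  have edge_pt y : disc y -> circle y -> dist2 y m <= r0 ->
      exists u, 0 < u < 1 /\ y = arc_pt (size (sides f)) i u.
    move=> dy cy yr; have [nv ne] := near_m y yr dy.
    have [[v fv]|[j [u [u01 yE]]]] := fmap_circle f cy; first by case: (nv v).
    exists u; split => //; rewrite yE (_ : j = i)//; apply: uniqif.
    apply: (ne _ (if (side j).2 then u else 1 - u) _ _).1.
      by case: ifP => _; case/andP: u01 => *; apply/andP; split; lra.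
    by rewrite yE fmap_arc_pt// itv_oo_cc.
  have [u [u01 pE]] := edge_pt p dp cp pr.
  have [u' [u01' pE']] := edge_pt p' dp' cp' pr'.
  move: ff; rewrite pE pE' !fmap_arc_pt ?itv_oo_cc// => ee.
  have b01 : 0 < (if (side i).2 then u else 1 - u) < 1.
    by case: ifP => _; case/andP: u01 => *; apply/andP; split; lra.
  have b01' : 0 <= (if (side i).2 then u' else 1 - u') <= 1.
    by case: ifP => _; case/andP: u01' => *; apply/andP; split; lra.
  have [_ uu] := emap_eq b01 b01' ee; congr arc_pt.
  by move: uu; case: ifP => // _ uu; lra.
- move=> r r_gt0; apply: (nbhs_cells hX).
  + by move=> v; have := @vmap_neq_emap _ _ _ v e _ half_itv.
  + move=> e' t t01 /esym ee; have [<- <-] := emap_eq half_itv t01 ee.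
    pose c u := arc_pt (size (sides f)) i (if (side i).2 then u else 1 - u) : R * R.
    have cc : cont_on setT c.
      apply: (@cont_on_comp _ _ _ setT setT _ (arc_pt (size (sides f)) i)) => //.
        by case: (side i).2; cont_tac.
      exact: cont_on_arc_pt.
    have : \forall u \near (1 / 2 : R), setT u -> dist2 (c u) m < r.
      apply: (@cont_on_near _ _ _ _ (1 / 2 : R) [set y | dist2 y m < r] cc Logic.I).
      rewrite /c.
      rewrite (_ : (if _ then _ else _) = 1 / 2); first exact: near_dist2.
      by case: ifP => _; lra.
    apply: filterS => u /(_ Logic.I) ur u01; exists (c u).
      by split => //; apply: circle_disc; exact: arc_pt_circle.
    rewrite /c fmap_arc_pt -/e.
      by case: (side i).2 => //; congr emap; lra.
    by case: ifP => // _; case/andP: u01 => *; apply/andP; split; lra.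
  + move=> f' p dp /(fmap_eq_mid dp)[i' [ie pE]].
    have [ef _] := uniqi _ _ ie; subst f'.
    have ii := uniqif _ ie; subst i'; rewrite pE.
    by apply: filterS (near_dist2 m r_gt0) => q qr dq; exists q.
move=> r' r g r'0 rr0 cg g0.
pose A := @disc R `&` [set p | r' <= dist2 p m <= r].
pose B := @disc R `&` [set p | dist2 p m <= r] `&` [set p | cdot m p < 1].
have cm1 : cdot m m = 1 by rewrite /cdot -!expr2; exact: cm.
apply: (@has_root_convex _ A B).
- apply: compact_closedI; first exact: compact_disc.
  exact: closed_dist2_ring.
- move=> p [dp /andP[pr' pr]]; split => //; apply: circle_cdot_lt1 => // pm.
  by move: pr'; rewrite pm /dist2 !subrr !expr0n addr0 leNgt r'0.
- move=> p q t [[dp pr] pm] [[dq qr] qm] t01; split; first split.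
  + exact: disc_lerp.
  + by apply: le_trans (dist2_lerp _ _ _ t01) _; exact: convex_comb_le.
  + by rewrite /= cdot_lerp; exact: convex_comb_lt.
- by apply: cont_on_sub cg => p [].
- by move=> p [[dp pr] /= pm]; apply: g0 => // pmE; move: pm; rewrite pmE cm1 ltxx.
Qed.

End FewSides.

Lemma near0_pos (R : realType) (P : R -> Prop) :
  (\forall s \near (0 : R), 0 < s -> P s) -> exists2 s, 0 < s & P s.
Proof.
move=> /nbhs_ballP[d /= d0 dP]; exists (d / 2); first by rewrite divr_gt0.
apply: dP; last by rewrite divr_gt0.
by rewrite /ball /= sub0r normrN gtr0_norm ?divr_gt0// ltr_pdivrMr// ltr_pMr// ltr1n.
Qed.

Lemma compact_pos_lower_bound (R : realType) (T : topologicalType) (A : set T) (g : T -> R) :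
  compact A -> cont_on A g -> (forall y, A y -> 0 < g y) ->
  exists2 a, 0 < a & forall y, A y -> a <= g y.
Proof.
move=> cA cg g0.
have : \forall a \near (0 : R), forall y, A y -> a < g y.
  move/compact_near_coveringP/near_covering_withinP : cA => cA.
  apply: (cA _ (nbhs (0 : R)) (fun a y => a < g y)) => y Ay.
  have gy := g0 y Ay.
  exists ([set y' | A y' -> g y / 2 < g y'], [set a | a < g y / 2]) => /=.
    split; last by apply: lt_nbhsl; rewrite divr_gt0.
    apply: (@cont_on_near _ _ _ _ y [set z : R | g y / 2 < z] cg Ay).
    by apply: lt_nbhsr; rewrite ltr_pdivrMr// ltr_pMr// ltr1n.
  by move=> [y' a] /= [h ah] Ay'; exact: lt_trans ah (h Ay').
move=> h; have [a a0 aP] : exists2 a : R, 0 < a & forall y, A y -> a < g y.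
  by apply: near0_pos; apply: filterS h => a ha _.
by exists a => // y /aP /ltW.
Qed.

(** * Folding the sides at an edge, and paths through one side *)

Section ManySides.
Context {R : realType} {X : topologicalType} {K : cellulation R X}.
Hypotheses (hX : hausdorff_space X) (cX : compact [set: X]) (lpX : locally_planar R X).
Implicit Types (v : vertex K) (e : edge K) (f : face K).

(** The inverse of [emap e] on the middle half of the edge, continuous by compactness, extends to
    [X] by Tietze's theorem, compact Hausdorff spaces being normal. *)
Lemma edge_coordinate e : exists rho : X -> R, cont_on setT rho /\
  forall t : R, 1 / 4 <= t <= 3 / 4 -> rho (emap e t) = t - 1 / 2.
Proof.
pose G : set R := `[1 / 4, 3 / 4]%classic; pose A := emap e @` G.
have GI t : G t -> 0 < t < 1.
  by rewrite /G /= in_itv /= => /andP[h1 h2]; apply/andP; split; lra.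
have cG : compact G by exact: segment_compact.
have ce : cont_on G (emap e).
  by apply: cont_on_sub (@cont_on_emap _ _ _ e) => t /GI /itv_oo_cc.
pose r y := xget 0 [set t | G t /\ emap e t = y].
have rE t : G t -> r (emap e t) = t.
  move=> Gt; rewrite /r; case: xgetP => [t' -> [Gt' ee]|/(_ t)]; last by case.
  by have [] := emap_eq (GI _ Gt') (itv_oo_cc (GI _ Gt)) ee.
have cr : cont_on A r by exact: (cont_on_inverse hX cG ce rE).
have clA : closed A.
  by apply: compact_closed => //; apply: continuous_compact cG; exact/cont_onP.
have cf : {within A, continuous (fun y => r y - 1 / 2 : R^o)}.
  by apply/cont_onP; apply: cont_onB => //; exact: cont_on_cst.
have fb y : A y -> `|r y - 1 / 2| <= 1.
  move=> [t Gt <-]; rewrite rE// ler_norml.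
  by have /andP[? ?] := GI _ Gt; apply/andP; split; lra.
have [rho [rhoE crho _]] :=
  continuous_bounded_extension (compact_normal hX cX) clA ltr01 cf fb.
exists rho; split; first exact: continuous_cont_on crho.
move=> t t4; have Gt : G t by rewrite /G /= in_itv.
by rewrite -rhoE ?rE// inE; exists t.
Qed.

Lemma side_mid_inj f (i j : 'I_(size (sides f))) : side_mid i = side_mid j -> i = j.
Proof. by move=> /(arc_pt_inj half_itv half_itv)[]. Qed.

Lemma side_mid_separated f (i : 'I_(size (sides f))) :
  exists2 d : R, 0 < d & forall j, j != i -> d < dist2 (side_mid j) (side_mid i).
Proof.
apply: near0_pos.
have : \forall d \near (0 : R), forall j, j != i -> d < dist2 (side_mid j) (side_mid i).
  apply: (@filter_forall _ _ (fun j d => j != i -> d < dist2 (side_mid j) (side_mid i)) (nbhs (0 : R))) => j.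
  have [->|ji] := eqVneq j i; first exact: filterE.
  have : \forall d \near (0 : R), d < dist2 (side_mid j) (side_mid i).
    by apply: lt_nbhsl; apply: dist2_gt0 => /side_mid_inj /eqP; exact/negP.
  by apply: filterS => d dj _.
by apply: filterS => d hd _.
Qed.

(* Coordinates near the midpoint of [e] folding the side [i] of [f] onto the
   upper half plane and all the other sides at [e] onto the lower one. *)
Lemma side_fold f (i : 'I_(size (sides f))) (e := (side i).1) :
  exists h : X -> R * R, [/\ cont_on setT h,
   forall t : R, 1 / 4 <= t <= 3 / 4 -> h (emap e t) = (t - 1 / 2, 0),
   \forall p \near side_mid i, disc p -> 0 <= (h (fmap f p)).2,
   forall f' (i' : 'I_(size (sides f'))), (side i').1 = e ->
     existT (fun f => 'I_(size (sides f))) f' i' <>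
     existT (fun f => 'I_(size (sides f))) f i ->
     \forall p \near side_mid i', disc p -> (h (fmap f' p)).2 <= 0
   & \forall y \near emap e (1 / 2), y <> emap e (1 / 2) -> h y != 0].
Proof.
have [rho [crho rhoE]] := edge_coordinate e.
have [d d0 dsep] := side_mid_separated i.
(* The sign of [tau] singles out the side [i]: positive near [side_mid i], negative near every other
   side midpoint, by the choice of [d] on the same face and by the value [-1] on the others. *)
pose tau f' (p : R * R) : R := if f' == f then d - dist2 p (side_mid i) else -1.
have ctau f' (A : set (R * R)) : cont_on A (tau f').
  rewrite /tau; case: (f' == f); last exact: cont_on_cst.
  by apply: cont_onB; [exact: cont_on_cst|apply: cont_on_dist2; exact: cont_on_id].
(* Second coordinate of the fold, zero on vertices and edges. The factor [1 - nsq] vanishes on the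
   circle and makes this extension continuous; the preimage picked by [cid] is unique. *)
pose v (y : X) : R :=
  if pselect (exists fp : face K * (R * R), open_disc fp.2 /\ fmap fp.1 fp.2 = y) is left h
  then (1 - nsq (projT1 (cid h)).2) * tau (projT1 (cid h)).1 (projT1 (cid h)).2
  else 0.
have v0 y : (forall f' p, open_disc p -> fmap f' p <> y) -> v y = 0.
  by move=> ny; rewrite /v; case: pselect => // -[[f' p] [/= op fy]]; case: (ny f' p).
have v_edge e' (t : R) : 0 <= t <= 1 -> v (emap e' t) = 0.
  by move=> t01; apply: v0 => f' p op; exact: fmap_open_neq_emap.
have vE f' p : disc p -> v (fmap f' p) = (1 - nsq p) * tau f' p.
  move=> /disc_cases[op|cp].
    rewrite /v; case: pselect => [h|nh]; last by exfalso; apply: nh; exists (f', p).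
    case: (cid h) => -[f'' p'] /= [op' ff].
    by have [-> ->] := fmap_open_eq op' (open_disc_disc op) ff.
  rewrite (_ : nsq p = 1); last exact: cp.
  rewrite subrr mul0r; apply: v0 => f'' p' op' ff.
  have [_ e1] := fmap_open_eq op' (circle_disc cp) ff.
  by move: op'; rewrite e1 /open_disc /= cp ltxx.
have cv : cont_on setT v.
  apply/cont_on_nearP => y W _ Wy; suff : \forall y' \near y, W (v y') by apply: filterS.
  apply: (@nbhs_cells R X K hX y [set y' | W (v y')]).
  - by move=> w _; exact: nbhs_singleton Wy.
  - move=> e' t t01 ty; apply: filterE => u u01 /=; rewrite v_edge//.
    by rewrite -(v_edge e' t t01) ty; exact: nbhs_singleton Wy.
  - move=> f' p dp fy.
    have cf : cont_on (@disc R) (fun p => (1 - nsq p) * tau f' p).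
      by apply: cont_onM; [rewrite /nsq; cont_tac|exact: ctau].
    have : \forall q \near p, disc q -> W ((1 - nsq q) * tau f' q).
      by apply: (cont_on_near cf dp); rewrite -vE// fy.
    by apply: filterS => q h dq /=; rewrite vE//; exact: h.
have tau_i : \forall p \near side_mid i, 0 < tau f p.
  have := @cont_on_near _ _ _ _ (side_mid i) [set y : R | 0 < y] (ctau f setT) Logic.I.
  move=> h; apply: filterS (h _) => [p|]; first by apply.
  by apply: lt_nbhsr; rewrite /tau eqxx /dist2 !subrr !expr0n addr0 subr0.
have tau_i' f' (i' : 'I_(size (sides f'))) :
    existT (fun f => 'I_(size (sides f))) f' i' <>
    existT (fun f => 'I_(size (sides f))) f i ->
    \forall p \near side_mid i', tau f' p < 0.
  move=> ne; have := @cont_on_near _ _ _ _ (side_mid i') [set y : R | y < 0] (ctau f' setT) Logic.I.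
  move=> h; apply: filterS (h _) => [p|]; first by apply.
  apply: lt_nbhsl; rewrite /tau; case: eqP => [ff|_]; last by rewrite oppr_lt0.
  subst f'; rewrite subr_lt0; apply: dsep; apply/eqP => ii; apply: ne.
  by rewrite ii.
have disc1 p : disc p -> 0 <= 1 - nsq p by rewrite subr_ge0.
exists (fun y => (rho y, v y)); split.
- by cont_tac.
- move=> t t4; rewrite rhoE// v_edge//.
  by case/andP: t4 => *; apply/andP; split; lra.
- by apply: filterS tau_i => p tp dp /=; rewrite vE// mulr_ge0 ?disc1// ltW.
- move=> f' i' ie /tau_i'; apply: filterS => p tp dp /=.
  by rewrite vE// mulr_ge0_le0 ?disc1// ltW.
(* On the edge, [rho] vanishes only at the midpoint; inside the faces, [v] is nonzero near the side
   midpoints. *)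
apply: (@nbhs_cells R X K hX).
- by move=> w we; have := @vmap_neq_emap _ _ _ w e _ half_itv.
- move=> e' t t01 /esym ee; have [<- <-] := emap_eq half_itv t01 ee.
  have h : \forall u \near (1 / 2 : R), 1 / 4 < u < 3 / 4.
    near=> u; apply/andP; split; near: u; first by apply: lt_nbhsr; lra.
    by apply: lt_nbhsl; lra.
  apply: filterS h => u /andP[u4 u3] u01 ue; rewrite rhoE; last by rewrite !ltW.
  rewrite -nsq_gt0 ltr_pwDl ?sqr_ge0// exprn_even_gt0//= subr_eq0.
  by apply/eqP => uh; apply: ue; rewrite uh.
move=> f' p dp fe; have [i' [ie pE]] := fmap_eq_mid dp fe.
have tn0 : \forall q \near p, tau f' q != 0.
  have [ii|ni] := pselect (existT (fun f => 'I_(size (sides f))) f' i' =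
    existT (fun f => 'I_(size (sides f))) f i).
    have ef := congr1 (@projT1 _ _) ii; rewrite /= in ef; subst f'.
    have {}ii := eq_from_Tagged ii; subst i'; rewrite pE.
    by apply: filterS tau_i => q; exact: lt0r_neq0.
  by rewrite pE; apply: filterS (tau_i' _ _ ni) => q; exact: ltr0_neq0.
have nq : \forall q \near p, disc q -> (forall w : vertex K, vmap w <> fmap f' q) /\
    (forall e' (t : R), 0 <= t <= 1 -> emap e' t = fmap f' q -> e' = e /\ 1 / 4 <= t <= 3 / 4).
  apply: (@cont_on_near _ _ _ _ p [set y : X | (forall w : vertex K, vmap w <> y) /\
    (forall e' (t : R), 0 <= t <= 1 -> emap e' t = y -> e' = e /\ 1 / 4 <= t <= 3 / 4)]
    (@cont_on_fmap _ _ _ f') dp); rewrite fe.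
  exact: near_edge_mid.
apply: filterS2 tn0 nq => q tq hq dq qx; have [nw ne] := hq dq.
rewrite -nsq_gt0 /nsq /=.
have [oq|cq] := disc_cases dq.
  rewrite ltr_wpDl ?sqr_ge0// exprn_even_gt0//= vE// mulf_neq0//.
  by rewrite subr_eq0 gt_eqF.
have [[w wE]|[e' [t [t01 tE]]]] := fmap_skeleton f' cq; first by case: (nw w).
have [ee t4] := ne e' t (itv_oo_cc t01) (esym tE); rewrite tE ee rhoE//.
rewrite ltr_pwDl ?sqr_ge0// exprn_even_gt0//= subr_eq0.
by apply/eqP => th; apply: qx; rewrite tE ee th.
Unshelve. all: by end_near. Qed.

(* The path runs along the chord of the disc below the arc of the side. *)
Lemma side_chord f (i : 'I_(size (sides f))) (e := (side i).1) (P : R * R -> Prop) :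
  (\forall p \near side_mid i, disc p -> P p) ->
  \forall s \near (0 : R), 0 < s -> exists g : R -> R * R,
    [/\ cont_on (@unit_itv R) g,
     forall t, 0 <= t <= 1 -> [/\ disc (g t), P (g t) & fmap f (g t) <> emap e (1 / 2)],
     fmap f (g 0) = emap e (1 / 2 + s) & fmap f (g 1) = emap e (1 / 2 - s)].
Proof.
move=> /nbhs_dist2[r r0 rP]; set m := side_mid i; set n := size (sides f).
have [d d0 dsep] := side_mid_separated i.
(* The bound [d] keeps the chord away from the midpoints of the other arcs. *)
pose r1 := Num.min r d; have r10 : 0 < r1 by rewrite lt_min r0.
have near_arc (sg : R) : \forall s \near (0 : R), dist2 (arc_pt n i (1 / 2 + sg * s)) m < r1.
  have cc : cont_on setT (fun s => dist2 (arc_pt n i (1 / 2 + sg * s)) m).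
    apply: cont_on_dist2.
    apply: (@cont_on_comp _ _ _ setT setT (fun s => 1 / 2 + sg * s) (arc_pt n i)) => //.
      by cont_tac.
    exact: cont_on_arc_pt.
  have h := @cont_on_near _ _ _ _ (0 : R) [set y : R | y < r1] cc Logic.I.
  apply: filterS (h _) => [s|]; first by apply.
  by apply: lt_nbhsl; rewrite mulr0 addr0 /m /side_mid /dist2 !subrr !expr0n addr0.
have small : \forall s \near (0 : R), s < 1 / 4 by apply: lt_nbhsl; lra.
near=> s => s0.
have s4 : s < 1 / 4 by near: s.
have np : dist2 (arc_pt n i (1 / 2 + 1 * s)) m < r1 by near: s; exact: near_arc.
have nm : dist2 (arc_pt n i (1 / 2 + (-1) * s)) m < r1 by near: s; exact: near_arc.
(* Orients the chord so that it starts at the edge parameter [1 / 2 + s], whichever way the side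
   runs. *)
pose sg : R := if (side i).2 then 1 else -1.
have sg1 : sg = 1 \/ sg = -1 by rewrite /sg; case: ifP; [left|right].
pose a := arc_pt n i (1 / 2 + sg * s); pose c := arc_pt n i (1 / 2 - sg * s).
have [ar cr] : dist2 a m < r1 /\ dist2 c m < r1.
  by rewrite /a /c; case: sg1 => ->; rewrite -mulNr ?opprK.
have [a01 c01] : 0 < 1 / 2 + sg * s < 1 /\ 0 < 1 / 2 - sg * s < 1.
  by case: sg1 => ->; split; apply/andP; split; lra.
have da : disc a by apply: circle_disc; exact: arc_pt_circle.
have dc : disc c by apply: circle_disc; exact: arc_pt_circle.
have arc_ne u : 0 < u < 1 -> u <> 1 / 2 -> arc_pt n i u <> m.
  by move=> u01 uh /(arc_pt_inj u01 half_itv)[_ /uh].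
have cm : circle m by exact: arc_pt_circle.
have am : cdot m a < 1.
  by apply: circle_cdot_lt1 => //; apply: arc_ne => //; case: sg1 => ->; lra.
have cm' : cdot m c < 1.
  by apply: circle_cdot_lt1 => //; apply: arc_ne => //; case: sg1 => ->; lra.
exists (fun t => lerp t a c); split.
- by rewrite /lerp; cont_tac.
- move=> t t01; have dl := disc_lerp t01 da dc.
  have lr : dist2 (lerp t a c) m < r1.
    by apply: le_lt_trans (dist2_lerp _ _ _ t01) _; exact: convex_comb_lt.
  split => //.
    apply: rP => //; apply/ltW; apply: lt_le_trans lr _.
    by rewrite ge_min lexx.
  move=> /(fmap_eq_mid dl)[j [je lE]].
  have ji : j = i.
    apply/eqP; apply: contraTT lr => /dsep dj; rewrite -leNgt lE ge_min.
    by rewrite (ltW dj) orbT.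
  (* Both ends lie in the open half plane that excludes [m], hence so does the chord. *)
  have : cdot m (lerp t a c) < 1 by rewrite cdot_lerp; exact: convex_comb_lt.
  by rewrite lE ji -/m /cdot -!expr2 (_ : _ + _ = 1) ?ltxx//; exact: cm.
- rewrite lerp0 fmap_arc_pt ?itv_oo_cc// -/e /sg; congr emap.
  by case: (side i).2; lra.
- rewrite lerp1 fmap_arc_pt ?itv_oo_cc// -/e /sg; congr emap.
  by case: (side i).2; lra.
Unshelve. all: by end_near. Qed.

End ManySides.

(** * At most two sides along an edge *)

Section TwoSides.
Context {R : realType} {X : topologicalType} {K : cellulation R X}.
Hypotheses (hX : hausdorff_space X) (cX : compact [set: X]) (lpX : locally_planar R X).
Implicit Types (v : vertex K) (e : edge K) (f : face K).

Local Notation page f i := (existT (fun g : face K => 'I_(size (sides g))) f i).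

(* Let [h1] fold the side [i1] up and [h3] fold [i3] up. On an annulus of a
   chart the nonvanishing maps modulo squares form a group of order two, so one
   of [h1], [h3], [h1 * h3] has a square root. But [h1] has none on a loop
   through [i1] and [i2], [h3] has none on a loop through [i3] and [i2], and
   on the former loop [h3] has a root, hence [h1 * h3] has none. *)
Lemma edge_no_three_sides f1 f2 f3 (i1 : 'I_(size (sides f1)))
    (i2 : 'I_(size (sides f2))) (i3 : 'I_(size (sides f3))) :
  (side i2).1 = (side i1).1 -> (side i3).1 = (side i1).1 ->
  page f2 i2 <> page f1 i1 -> page f3 i3 <> page f1 i1 -> page f3 i3 <> page f2 i2 ->
  False.
Proof.
set e := (side i1).1 => e2 e3 n21 n31 n32.
set x := emap e (1 / 2).
have [h1 [ch1 h1E up1 low1 h1n0]] := side_fold hX cX i1.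
have [h3 [ch3 h3E up3 low3 h3n0]] := side_fold hX cX i3.
rewrite e3 -/e -/x in h3E up3 low3 h3n0; rewrite -/e -/x in h1E low1 h1n0.
have [U [phi [psi [b [[oU Ux] [cphi phix] phiK [b0 psiK] cpsi]]]]] := centered_chart x lpX.
have ball0 c : 0 < c -> nsq (0 : R * R) <= c by move=> /ltW; rewrite /nsq /= !expr0n addr0.
have psi0 : psi 0 = x by rewrite -phix phiK.
(* In this disc both folds vanish at most at the centre, as the dichotomy on annuli requires. *)
have [c [c0 cb cN]] : exists c, [/\ 0 < c, c <= b & forall p, nsq p <= c ->
    psi p <> x -> h1 (psi p) != 0 /\ h3 (psi p) != 0].
  have : \forall p \near (0 : R * R), nsq p <= b ->
      (psi p <> x -> h1 (psi p) != 0) /\ (psi p <> x -> h3 (psi p) != 0).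
    apply: (@cont_on_near _ _ _ _ (0 : R * R)
      [set y | (y <> x -> h1 y != 0) /\ (y <> x -> h3 y != 0)] cpsi (ball0 _ b0)).
    by rewrite psi0; exact: filterI.
  move=> /nbhs_dist2[d d0 h]; exists (Num.min d b); rewrite lt_min d0 b0 ge_min lexx orbT.
  split => // p; rewrite le_min => /andP[pd pb] px.
  have [] := h p _ pb; first by rewrite /dist2 !subr0.
  by move=> /(_ px) ? /(_ px).
have near_side f (i : 'I_(size (sides f))) : (side i).1 = e ->
    \forall p \near side_mid i, disc p -> U (fmap f p) /\ nsq (phi (fmap f p)) <= c.
  move=> ie; have dm : disc (side_mid i) by apply: circle_disc; exact: arc_pt_circle.
  apply: (@cont_on_near _ _ _ _ _ [set y | U y /\ nsq (phi y) <= c] (@cont_on_fmap _ _ _ f) dm).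
  rewrite fmap_side_mid ie -/x.
  have nU : nbhs x U by exact: open_nbhs_nbhs.
  have : \forall y \near x, U y -> [set z : R | z < c] (nsq (phi y)).
    apply: (cont_on_near (cont_on_nsq cphi) Ux); apply: lt_nbhsl.
    by rewrite phix /nsq /= !expr0n addr0.
  by apply: filterS2 nU => y Uy /(_ Uy) /= /ltW.
pose S g h : set X := [set y | exists2 t : R, 0 <= t <= 1 & y = g t \/ y = h t].
pose goodpath (g : R -> X) := cont_on (@unit_itv R) g /\
  forall t, 0 <= t <= 1 -> [/\ U (g t), nsq (phi (g t)) <= c & g t <> x].
(* One path per side, all with the same ends on the edge: [h1] sends [g1] up and the others down,
   [h3] sends [g3] up and the others down. *)
have paths : \forall s \near (0 : R), 0 < s -> exists g1 g2 g3 : R -> X,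
  [/\ [/\ goodpath g1, goodpath g2 & goodpath g3],
   [/\ g1 0 = emap e (1 / 2 + s), g2 0 = emap e (1 / 2 + s) & g3 0 = emap e (1 / 2 + s)],
   [/\ g1 1 = emap e (1 / 2 - s), g2 1 = emap e (1 / 2 - s) & g3 1 = emap e (1 / 2 - s)],
   forall t, 0 <= t <= 1 -> [/\ 0 <= (h1 (g1 t)).2, (h1 (g2 t)).2 <= 0 & (h1 (g3 t)).2 <= 0]
   & forall t, 0 <= t <= 1 -> [/\ (h3 (g1 t)).2 <= 0, (h3 (g2 t)).2 <= 0 & 0 <= (h3 (g3 t)).2]].
  have mk f (i : 'I_(size (sides f))) (P : X -> Prop) : (side i).1 = e ->
      (\forall p \near side_mid i, disc p -> P (fmap f p)) ->
      \forall s \near (0 : R), 0 < s -> exists g : R -> X, [/\ goodpath g,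
        g 0 = emap e (1 / 2 + s), g 1 = emap e (1 / 2 - s) & forall t, 0 <= t <= 1 -> P (g t)].
    move=> ie nP.
    have nn : \forall p \near side_mid i, disc p ->
        (U (fmap f p) /\ nsq (phi (fmap f p)) <= c) /\ P (fmap f p).
      by apply: filterS2 (near_side f i ie) nP => p h1p h2p dp; split; [exact: h1p|exact: h2p].
    have := side_chord nn; rewrite ie; apply: filterS => s hs s0.
    have [g [cg gP g0 g1]] := hs s0; exists (fmap f \o g); split => //.
      split; first by apply: cont_on_comp cg (@cont_on_fmap _ _ _ f) => t /gP[].
      by move=> t /gP[_ [[? ?] _]] ?; split.
    by move=> t /gP[_ [_ ?] _].
  have k1 := mk f1 i1 (fun y => 0 <= (h1 y).2 /\ (h3 y).2 <= 0) erefl.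
  have k2 := mk f2 i2 (fun y => (h1 y).2 <= 0 /\ (h3 y).2 <= 0) e2.
  have k3 := mk f3 i3 (fun y => (h1 y).2 <= 0 /\ 0 <= (h3 y).2) e3.
  have comb (m : R * R) (P Q : R * R -> Prop) : (\forall p \near m, disc p -> P p) ->
      (\forall p \near m, disc p -> Q p) -> \forall p \near m, disc p -> P p /\ Q p.
    by apply: filterS2 => p hP hQ dp; split; [exact: hP|exact: hQ].
  have {}k1 := k1 (comb _ _ _ up1 (low3 _ i1 erefl (nesym n31))).
  have {}k2 := k2 (comb _ _ _ (low1 _ i2 e2 n21) (low3 _ i2 e2 (nesym n32))).
  have {}k3 := k3 (comb _ _ _ (low1 _ i3 e3 n31) up3).
  apply: filterS3 k1 k2 k3 => s k1 k2 k3 s0.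
  have [g1 [gg1 g10 g11 P1]] := k1 s0; have [g2 [gg2 g20 g21 P2]] := k2 s0.
  have [g3 [gg3 g30 g31 P3]] := k3 s0.
  exists g1, g2, g3; split => // t t01; have [? ?] := P1 t t01;
    have [? ?] := P2 t t01; have [? ?] := P3 t t01; by split.
have small : \forall s \near (0 : R), s < 1 / 4 by apply: lt_nbhsl; lra.
have [s s0 [s4 [g1 [g2 [g3 [[gg1 gg2 gg3] [g10 g20 g30] [g11 g21 g31] P1 P3]]]]]] :
    exists2 s : R, 0 < s & s < 1 / 4 /\ exists g1 g2 g3 : R -> X,
  [/\ [/\ goodpath g1, goodpath g2 & goodpath g3],
   [/\ g1 0 = emap e (1 / 2 + s), g2 0 = emap e (1 / 2 + s) & g3 0 = emap e (1 / 2 + s)],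
   [/\ g1 1 = emap e (1 / 2 - s), g2 1 = emap e (1 / 2 - s) & g3 1 = emap e (1 / 2 - s)],
   forall t, 0 <= t <= 1 -> [/\ 0 <= (h1 (g1 t)).2, (h1 (g2 t)).2 <= 0 & (h1 (g3 t)).2 <= 0]
   & forall t, 0 <= t <= 1 -> [/\ (h3 (g1 t)).2 <= 0, (h3 (g2 t)).2 <= 0 & 0 <= (h3 (g3 t)).2]].
  by apply: near0_pos; apply: filterS2 small paths => s s4 hs s0; split => //; exact: hs.
have lower g : goodpath g -> exists2 a, 0 < a & forall t, 0 <= t <= 1 -> a <= nsq (phi (g t)).
  move=> [cg gP]; apply: (compact_pos_lower_bound (A := @unit_itv R) (g := fun t => nsq (phi (g t)))).
  - exact: compact_unit_itv.
  - by apply: cont_on_nsq; apply: (cont_on_comp _ cg cphi) => t /gP[].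
  - move=> t /gP[Ut _ gx]; rewrite nsq_gt0; apply/eqP => p0; apply: gx.
    by rewrite -(phiK _ Ut) p0 psi0.
have [a1 a10 A1] := lower g1 gg1; have [a2 a20 A2] := lower g2 gg2.
have [a3 a30 A3] := lower g3 gg3.
(* The paths are compact and avoid [x], so a common inner radius places all of them in one annulus
   of the chart. *)
pose a := Num.min a1 (Num.min a2 a3).
have a0 : 0 < a by rewrite !lt_min a10 a20.
have I0 : 0 <= (0 : R) <= 1 by rewrite lexx ler01.
have I1 : 0 <= (1 : R) <= 1 by rewrite lexx ler01.
have aP1 t : 0 <= t <= 1 -> a <= nsq (phi (g1 t)).
  by move=> /A1; apply: le_trans; rewrite ge_min lexx.
have aP2 t : 0 <= t <= 1 -> a <= nsq (phi (g2 t)).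
  by move=> /A2; apply: le_trans; rewrite !ge_min lexx orbT.
have aP3 t : 0 <= t <= 1 -> a <= nsq (phi (g3 t)).
  by move=> /A3; apply: le_trans; rewrite !ge_min lexx !orbT.
have ac : a <= c by apply: le_trans (aP1 0 I0) _; case: (gg1.2 0 I0).
pose Y := [set y | [/\ U y, annulus a c (phi y) & y <> x]].
have SY g h : goodpath g -> goodpath h ->
    (forall t, 0 <= t <= 1 -> a <= nsq (phi (g t))) ->
    (forall t, 0 <= t <= 1 -> a <= nsq (phi (h t))) -> S g h `<=` Y.
  move=> [_ gP] [_ hP] ag ah _ [t t01 [->|->]].
    by have [? ? ?] := gP t t01; split => //; apply/andP; split => //; exact: ag.
  by have [? ? ?] := hP t t01; split => //; apply/andP; split => //; exact: ah.
have S12 := SY g1 g2 gg1 gg2 aP1 aP2; have S32 := SY g3 g2 gg3 gg2 aP3 aP2.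
have Yn0 y : Y y -> h1 y != 0 /\ h3 y != 0.
  move=> [Uy /andP[_ yc] yx]; have := cN (phi y) yc.
  by rewrite phiK//; exact.
have no1 : ~ has_root (S g1 g2) h1.
  apply: (@no_root_two_paths _ _ _ _ g1 g2).
  - exact: cont_on_sub ch1.
  - by move=> y /S12 /Yn0[].
  - exact: gg1.1.
  - exact: gg2.1.
  - by move=> t t01; split; [exists t => //; left|case: (P1 t t01)].
  - by move=> t t01; split; [exists t => //; right|case: (P1 t t01)].
  - by rewrite g10 g20.
  - by rewrite g11 g21.
  - rewrite g10 h1E /=; first by rewrite addrAC subrr add0r.
    by apply/andP; split; lra.
  - rewrite g11 h1E /=; first by rewrite addrAC subrr add0r oppr_lt0.
    by apply/andP; split; lra.
have no3 : ~ has_root (S g3 g2) h3.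
  apply: (@no_root_two_paths _ _ _ _ g3 g2).
  - exact: cont_on_sub ch3.
  - by move=> y /S32 /Yn0[].
  - exact: gg3.1.
  - exact: gg2.1.
  - by move=> t t01; split; [exists t => //; left|case: (P3 t t01)].
  - by move=> t t01; split; [exists t => //; right|case: (P3 t t01)].
  - by rewrite g30 g20.
  - by rewrite g31 g21.
  - rewrite g30 h3E /=; first by rewrite addrAC subrr add0r.
    by apply/andP; split; lra.
  - rewrite g31 h3E /=; first by rewrite addrAC subrr add0r oppr_lt0.
    by apply/andP; split; lra.
have cphiY A : A `<=` Y -> cont_on A phi.
  by move=> AY; apply: cont_on_sub cphi => y /AY[].
have pull1 A (F : X -> R * R) : A `<=` Y ->
    has_root (annulus a c) (F \o psi) -> has_root A F.
  move=> AY hr; apply: (has_root_eq (f := (F \o psi) \o phi)).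
    by move=> y /AY[Uy _ _] /=; rewrite phiK.
  by apply: has_root_comp hr; [move=> y /AY[]|exact: cphiY].
have pull2 A (F : X -> R * R) : A `<=` Y ->
    has_root (annulus a c) (fun p => cmul p ((F \o psi) p)) ->
    has_root A (fun y => cmul (phi y) (F y)).
  move=> AY hr; apply: (has_root_eq (f := (fun p => cmul p ((F \o psi) p)) \o phi)).
    by move=> y /AY[Uy _ _] /=; rewrite phiK.
  by apply: has_root_comp hr; [move=> y /AY[]|exact: cphiY].
have psix p : punctured_disc c p -> psi p <> x.
  move=> [p0 pc] px; move: p0; rewrite -(psiK p _).2; last exact: le_trans cb.
  by rewrite px phix eqxx.
have cpsic : cont_on (punctured_disc c) psi.
  by apply: cont_on_sub cpsi => p [_ pc]; exact: le_trans cb.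
have dich1 := @annulus_root_dichotomy _ a c (h1 \o psi) a0 ac.
have dich3 := @annulus_root_dichotomy _ a c (h3 \o psi) a0 ac.
case: dich1.
- exact: (cont_on_comp (B := setT) _ cpsic ch1).
- by move=> p pc; have [_ pc'] := pc; case: (cN p pc' (psix p pc)).
- by move/(pull1 _ _ S12).
move=> r1; case: dich3.
- exact: (cont_on_comp (B := setT) _ cpsic ch3).
- by move=> p pc; have [_ pc'] := pc; case: (cN p pc' (psix p pc)).
- by move/(pull1 _ _ S32).
(* By the dichotomy both folds acquire roots after multiplication by the identity. On the loop of
   [g1] and [g2], [h3] stays in the lower half plane and has a root; so [phi] has one there, and
   then [h1] too. *)
move=> r3; apply: no1.
have {}r1 := pull2 _ _ S12 r1; have {}r3 := pull2 _ _ S12 r3.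
have h3root : has_root (S g1 g2) h3.
  apply: has_root_lower; first exact: cont_on_sub ch3.
  move=> y Sy; split; first by case: (Yn0 y (S12 y Sy)).
  by case: Sy => t t01 [->|->]; case: (P3 t t01).
have phiroot := has_root_div r3 h3root.
apply: (has_root_div (g := phi)) phiroot.
by apply: has_root_eq r1 => y _; rewrite cmulC.
Qed.

End TwoSides.

(** * Connectivity of the faces across edges *)

Section DualConnectivity.
Context {R : realType} {X : topologicalType} {K : cellulation R X}.
Hypotheses (hX : hausdorff_space X) (lpX : locally_planar R X)
  (conX : connected [set: X]).
Implicit Types (v : vertex K) (e : edge K) (f : face K) (S : set (face K)).

Definition closed_faces S : set X := [set y | exists f p, [/\ S f, disc p & fmap f p = y]].

Lemma closed_closed_faces S : closed (closed_faces S).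
Proof.
rewrite -openC openE => y ny.
have : \forall y' \near y, forall f, S f -> forall p, disc p -> fmap f p <> y'.
  apply: (@filter_forall _ _ (fun f y' => S f -> forall p, disc p -> fmap f p <> y') (nbhs y)) => f.
  have [Sf|nSf] := pselect (S f); last by apply: filterE => y' /nSf.
  have := near_not_image hX compact_disc (@cont_on_fmap _ _ _ f) (y := y).
  move=> h; have {}h : \forall y' \near y, forall p, disc p -> fmap f p <> y'.
    by apply: h => p dp fy; apply: ny; exists f, p.
  by apply: filterS h => y' h _.
by apply: filterS => y' h [f [p [Sf dp]]]; exact: h.
Qed.

Lemma near_open_disc p : disc p -> forall W : set (R * R), nbhs p W ->
  exists q, [/\ open_disc q, W q & q <> p \/ open_disc p].
Proof.
move=> dp W Wp; have [op|cp] := disc_cases dp.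
  by exists p; split => //; [exact: nbhs_singleton|right].
have cl : cont_on setT (fun t => lerp t p 0) by rewrite /lerp; cont_tac.
have : \forall t \near (0 : R), setT t -> W (lerp t p 0).
  by apply: (cont_on_near cl Logic.I); rewrite lerp0.
have small : \forall t \near (0 : R), t < 1 by apply: lt_nbhsl.
move=> hW; have [t t0 [t1 Wt]] : exists2 t : R, 0 < t & t < 1 /\ W (lerp t p 0).
  by apply: near0_pos; apply: filterS2 small hW => t t1 /(_ Logic.I).
have ol : open_disc (lerp t p 0).
  have -> : open_disc (lerp t p 0) = (nsq (lerp t p 0) < 1) by [].
  have -> : nsq (lerp t p 0) = (1 - t) ^+ 2 * nsq p by rewrite /nsq /=; ring.
  rewrite (_ : nsq p = 1) ?mulr1; last exact: cp.
  rewrite -subr_gt0 (_ : 1 - _ = t * (2 - t)); last by ring.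
  by rewrite mulr_gt0// subr_gt0 (lt_trans t1)// ltr1n.
exists (lerp t p 0); split => //; left => lp; move: ol.
by rewrite lp /open_disc /= cp ltxx.
Qed.

Lemma chart_not_isolated (x : X) (W : set X) : nbhs x W -> exists2 y, W y & y <> x.
Proof.
move=> Wx; have [U [phi [psi [b [[oU Ux] [cphi phix] phiK [b0 psiK] cpsi]]]]] := centered_chart x lpX.
have b00 : nsq (0 : R * R) <= b by rewrite /nsq /= !expr0n addr0 ltW.
have psi0 : psi 0 = x by rewrite -phix phiK.
have : \forall p \near (0 : R * R), nsq p <= b -> W (psi p).
  by apply: (cont_on_near cpsi b00); rewrite psi0.
move=> /nbhs_dist2[d d0 h]; pose r := Num.sqrt (Num.min d b).
have m0 : 0 < Num.min d b by rewrite lt_min d0.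
have r0 : 0 < r by rewrite sqrtr_gt0.
have rE : nsq (r, 0) = Num.min d b.
  by rewrite /nsq /= expr0n addr0 sqr_sqrtr// ltW.
have rb : nsq (r, 0) <= b by rewrite rE ge_min lexx orbT.
exists (psi (r, 0)).
  by apply: h => //; rewrite /dist2 /= !subr0 -/(nsq (r, 0)) rE ge_min lexx.
move=> px; have := (psiK _ rb).2; rewrite px phix => -[] r0'.
by move: r0; rewrite -r0' ltxx.
Qed.

(** Edges are covered by [edge_has_side]. An uncovered vertex would be isolated, since the covered
    points form a closed set and the vertices are finitely many; a chart excludes this. *)
Lemma face_cover y : closed_faces setT y.
Proof.
have edge_in e (t : R) : 0 < t < 1 -> closed_faces setT (emap e t).
  move=> t01; have [f [i ie]] := edge_has_side hX lpX e.
  exists f, (arc_pt (size (sides f)) i (if (side i).2 then t else 1 - t)); split => //.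
    by apply: circle_disc; exact: arc_pt_circle.
  rewrite fmap_arc_pt; last first.
    by case: (side i).2; case/andP: t01 => *; apply/andP; split; lra.
  rewrite ie; by case: (side i).2 => //; congr emap; lra.
have [[v ->]|[e [t [t01 ->]]]|[f [p [op ->]]]] := cell_cases (K := K) y; last 2 first.
- exact: edge_in.
- by exists f, p; split => //; exact: open_disc_disc.
apply: contrapT => nv.
have h1 : \forall y' \near vmap v, ~ closed_faces setT y'.
  apply: open_nbhs_nbhs; split => //; apply: closed_openC; exact: closed_closed_faces.
have h2 : \forall y' \near vmap v, forall v', v' <> v -> vmap v' <> y'.
  by apply: near_not_vertex => // v' vv' /vmap_eq.
have [y' [ny' nv'] yv] := chart_not_isolated (filterI h1 h2).
have [[v' e1]|[e [t [t01 e1]]]|[f [p [op e1]]]] := cell_cases (K := K) y'.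
- have [vv|vv] := pselect (v' = v); first by apply: yv; rewrite e1 vv.
  exact: nv' vv (esym e1).
- by apply: ny'; rewrite e1; exact: edge_in.
- by apply: ny'; exists f, p; split => //; exact: open_disc_disc.
Qed.

Lemma closed_facesU S : closed_faces S `|` closed_faces (~` S) = setT.
Proof.
apply/seteqP; split => // y _; have [f [p [_ dp fy]]] := face_cover y.
by have [Sf|nSf] := pselect (S f); [left|right]; exists f, p.
Qed.

(* Near a vertex common to both families the punctured disc of a chart, which
   is connected, would be split into two closed pieces. *)
Lemma closed_faces_disjoint S :
  (forall f f' (i : 'I_(size (sides f))) (i' : 'I_(size (sides f'))),
    S f -> (side i).1 = (side i').1 -> S f') ->
  closed_faces S `&` closed_faces (~` S) = set0.
Proof.
move=> Sclosed; rewrite -subset0 => y [Py Qy].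
(* A common point inside a face would put that face in both families; one inside an edge would make
   faces of different families adjacent. *)
have vertexPQ z : closed_faces S z -> closed_faces (~` S) z -> exists v, z = vmap v.
  move=> [f [p [Sf dp fz]]] [f' [p' [nSf' dp' fz']]].
  have [[v ->]|[e [t [t01 ze]]]|[g [q [oq zg]]]] := cell_cases (K := K) z.
  - by exists v.
  - have [i [u [_ _ ie _]]] := fmap_eq_emap dp t01 (etrans fz ze).
    have [i' [u' [_ _ ie' _]]] := fmap_eq_emap dp' t01 (etrans fz' ze).
    by case: nSf'; apply: (Sclosed f f' i i') => //; rewrite ie ie'.
  - have [gf _] := fmap_open_eq oq dp (etrans (esym zg) (esym fz)).
    have [gf' _] := fmap_open_eq oq dp' (etrans (esym zg) (esym fz')).
    by case: nSf'; rewrite -gf' gf.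
have [v yv] := vertexPQ y Py Qy.
have [U [phi [psi [b [[oU Uy] [cphi phiy] phiK [b0 psiK] cpsi]]]]] := centered_chart y lpX.
have b00 : nsq (0 : R * R) <= b by rewrite /nsq /= !expr0n addr0 ltW.
have psi0 : psi 0 = y by rewrite -phiy phiK.
have nv : \forall y' \near y, forall v', v' <> v -> vmap v' <> y'.
  by rewrite yv; apply: near_not_vertex => // v' vv' /vmap_eq.
have [c [c0 cb cN]] : exists c, [/\ 0 < c, c <= b & forall p, nsq p <= c ->
    forall v', v' <> v -> vmap v' <> psi p].
  have : \forall p \near (0 : R * R), nsq p <= b -> forall v', v' <> v -> vmap v' <> psi p.
    apply: (@cont_on_near _ _ _ _ _ [set y' | forall v', v' <> v -> vmap v' <> y'] cpsi b00).
    by rewrite psi0.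
  move=> /nbhs_dist2[d d0 h]; exists (Num.min d b); rewrite lt_min d0 b0 ge_min lexx orbT.
  split => // p; rewrite le_min => /andP[pd pb]; apply: h pb.
  by rewrite /dist2 !subr0.
pose B := [set p : R * R | p != 0 /\ nsq p < c].
have Bb p : B p -> nsq p <= b by move=> [_ /ltW pc]; exact: le_trans cb.
have Bx p : B p -> psi p <> y.
  move=> Bp py; have [_ e] := psiK p (Bb p Bp); case: Bp => p0 _.
  by move: p0; rewrite -e py phiy eqxx.
have PQ p : B p -> closed_faces S (psi p) -> ~ closed_faces (~` S) (psi p).
  move=> Bp PS QS; have [v' ev'] := vertexPQ _ PS QS.
  have [vv|vv] := pselect (v' = v); first by apply: (Bx p Bp); rewrite ev' vv yv.
  by apply: (cN p _ v' vv); [case: Bp => _ /ltW|rewrite ev'].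
have QP p : B p -> ~ closed_faces S (psi p) -> closed_faces (~` S) (psi p).
  move=> Bp nS; have : (closed_faces S `|` closed_faces (~` S)) (psi p) by rewrite closed_facesU.
  by case.
have cB : cont_on B psi by apply: cont_on_sub cpsi => p; exact: Bb.
have same : forall p q, B p -> B q ->
    (closed_faces S (psi p) <-> closed_faces S (psi q)).
  apply: (@punctured_disc_equiv _ c (fun p q => closed_faces S (psi p) <-> closed_faces S (psi q))).
  - by [].
  - by move=> p q _ _ [].
  - by move=> p q r _ _ _ h1 h2; exact: iff_trans h1 h2.
  move=> p Bp; have [Sp|nSp] := pselect (closed_faces S (psi p)).
    have : \forall q \near p, B q -> ~ closed_faces (~` S) (psi q).
      apply: (@cont_on_near _ _ _ _ p (~` closed_faces (~` S)) cB Bp).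
      apply: open_nbhs_nbhs; split; last exact: PQ.
      by apply: closed_openC; exact: closed_closed_faces.
    apply: filterS => q h Bq; split => // _; apply: contrapT => nS.
    exact: (h Bq) (QP q Bq nS).
  have : \forall q \near p, B q -> ~ closed_faces S (psi q).
    apply: (@cont_on_near _ _ _ _ p (~` closed_faces S) cB Bp).
    apply: open_nbhs_nbhs; split => //.
    by apply: closed_openC; exact: closed_closed_faces.
  by apply: filterS => q h Bq; split => // /(h Bq).
(* The interior of a face accumulates at its boundary points, so each family containing [y] enters
   the punctured disc. *)
have meets S' : closed_faces S' y -> exists2 p, B p & closed_faces S' (psi p).
  move=> [f [p [Sf dp fy]]].
  have nW : \forall q \near p, disc q -> U (fmap f q) /\ nsq (phi (fmap f q)) < c.
    apply: (@cont_on_near _ _ _ _ p [set z | U z /\ nsq (phi z) < c] (@cont_on_fmap _ _ _ f) dp).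
    rewrite fy; have nU : nbhs y U by exact: open_nbhs_nbhs.
    have : \forall z \near y, U z -> [set r : R | r < c] (nsq (phi z)).
      apply: (cont_on_near (cont_on_nsq cphi) Uy); apply: lt_nbhsl.
      by rewrite phiy /nsq /= !expr0n addr0.
    by apply: filterS2 nU => z Uz /(_ Uz).
  have [q [oq /(_ (open_disc_disc oq))[Uq qc] _]] := near_open_disc dp nW.
  exists (phi (fmap f q)).
    split => //; apply/eqP => p0; have := phiK _ Uq; rewrite p0 psi0 yv => /esym.
    exact: fmap_open_neq_vmap.
  by rewrite phiK//; exists f, q; split => //; exact: open_disc_disc.
have [p Bp Pp] := meets _ Py; have [q Bq Qq] := meets _ Qy.
by apply: (PQ q Bq) Qq; apply/(same p q Bp Bq).
Qed.

Lemma dual_connected S :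
  (forall f f' (i : 'I_(size (sides f))) (i' : 'I_(size (sides f'))),
    S f -> (side i).1 = (side i').1 -> S f') ->
  S !=set0 -> forall f, S f.
Proof.
move=> Sclosed [f0 Sf0] f; apply: contrapT => nSf.
have d00 : disc (0 : R * R) by rewrite /disc /= !expr0n addr0 ler01.
have PT : closed_faces S = setT.
  apply: conX.
  - by exists (fmap f0 0), f0, 0.
  - exists (~` closed_faces (~` S)); first exact/closed_openC/closed_closed_faces.
    rewrite setTI; apply/seteqP; split => y.
      move=> Py Qy; have : (closed_faces S `&` closed_faces (~` S)) y by [].
      by rewrite closed_faces_disjoint.
    by move=> nQ; have [//|/nQ] : (closed_faces S `|` closed_faces (~` S)) y by rewrite closed_facesU.
  - exists (closed_faces S); first exact: closed_closed_faces.
    by rewrite setTI.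
have : (closed_faces S `&` closed_faces (~` S)) (fmap f 0).
  by split; [rewrite PT|exists f, 0].
by rewrite closed_faces_disjoint.
Qed.

End DualConnectivity.

(** * Fluxes *)

Local Close Scope classical_set_scope.
Local Open Scope set_scope.

Lemma Z2_cases (x : 'Z_2) : x = 0 \/ x = 1.
Proof.
case: x => [[|[|//]]] ?; [left|right]; exact: val_inj.
Qed.

Lemma Z2_mulrn_parity (V : zmodType) (y : V) n : y + y = 0 ->
  (n%:R : 'Z_2) = 0 -> y *+ n = 0.
Proof.
move=> yy; rewrite -[n]odd_double_half natrD -mul2n natrM mulrnDr mulrnA mulr2n yy.
rewrite mul0rn addr0 (_ : 2%:R = 0 :> 'Z_2); last exact: val_inj.
by rewrite mul0r addr0; case: odd => // /(congr1 val).
Qed.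

Section Fluxes.
Variables (R : realType) (X : topologicalType) (K : cellulation R X).
Hypotheses (surfX : closed_surface R X) (connX : connected_space X).
Implicit Types (mu nu : flux K) (A : cochain1 K) (e : edge K) (f : face K).

Let hX : hausdorff_space X. Proof. by case: surfX. Qed.
Let cX : compact [set: X]%classic. Proof. by case: surfX. Qed.
Let lpX : locally_planar R X. Proof. by case: surfX. Qed.

Local Notation sideT := {f : face K & 'I_(size (sides f))}.

(** A side is a face with an index along its boundary, so an edge that one face runs through twice
    has two sides there. *)
Definition edge_sides e : {set sideT} := [set s : sideT | (side (tagged s)).1 == e].

Lemma card_edge_sides e : #|edge_sides e| = 2.
Proof.
have [f [i ie]] := edge_has_side hX lpX e.
have [f' [i' [ie' ne]]] := edge_second_side hX lpX i.
pose s : sideT := existT _ f i; pose s' : sideT := existT _ f' i'.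
have ss' : s' != s by exact/eqP.
have es : edge_sides e = [set s; s'].
  apply/setP => -[g j]; rewrite !inE; apply/idP/idP => [/eqP /= je|/orP[]/eqP -> /=].
  - rewrite -[_ || _]negbK negb_or; apply/negP => /andP[/eqP n1 /eqP n2].
    apply: (@edge_no_three_sides _ _ K hX cX lpX _ _ _ i i' j) => //.
    by rewrite je.
  - exact/eqP.
  - by rewrite ie' ie.
by rewrite es cards2 eq_sym ss'.
Qed.

Lemma deltaE A f : delta A f = \sum_(i < size (sides f)) A (side i).1.
Proof. by rewrite ffunE big_tnth. Qed.

Lemma total_parityB : {morph @total_parity R X K : mu nu / mu - nu}.
Proof.
by move=> mu nu; rewrite /total_parity -sumrB; apply: eq_bigr => f _; rewrite !ffunE.
Qed.

Lemma deltaD A A' : delta (A + A') = delta A + delta A'.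
Proof.
by apply/ffunP => f; rewrite !ffunE -big_split; apply: eq_bigr => s _; rewrite ffunE.
Qed.

Lemma Z2_addrr (x : 'Z_2) : x + x = 0.
Proof. by case: (Z2_cases x) => ->; exact: val_inj. Qed.

Lemma flux_addrr mu : mu + mu = 0.
Proof. by apply/ffunP => f; rewrite !ffunE Z2_addrr. Qed.

Lemma flux_oppr mu : - mu = mu.
Proof. by apply/eqP; rewrite eq_sym -subr_eq0 opprK flux_addrr. Qed.

(** Grouping the sides by edge instead of by face, each [A e] occurs exactly twice. *)
Lemma total_parity_delta A : total_parity (delta A) = 0.
Proof.
rewrite /total_parity; under eq_bigr do rewrite deltaE.
rewrite sig_big_dep /= (partition_big (fun s : sideT => (side (tagged s)).1) predT) //=.
apply: big1 => e _; rewrite (eq_bigr (fun=> A e)); last by move=> s /eqP ->.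
rewrite (eq_bigl [in edge_sides e]); last by move=> s; rewrite inE.
by rewrite sumr_const card_edge_sides mulr2n Z2_addrr.
Qed.

Definition face_flux f : flux K := [ffun g => (g == f)%:R].

Lemma total_parity_face_flux f : total_parity (face_flux f) = 1.
Proof.
rewrite /total_parity (bigD1 f)//= ffunE eqxx big1 ?addr0// => g gf.
by rewrite ffunE (negbTE gf).
Qed.

Lemma flux_sum mu : mu = \sum_f face_flux f *+ nat_of_ord (mu f).
Proof.
apply/ffunP => g; rewrite sum_ffunE (bigD1 g)//= big1 ?addr0 => [|f fg].
  by rewrite ffunMnE ffunE eqxx natr_Zp.
by rewrite ffunMnE ffunE eq_sym (negbTE fg) mul0rn.
Qed.

Lemma B2_delta A : delta A \in B2 K.
Proof. by apply/existsP; exists A. Qed.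

(** Distinct sides are the two sides of the edge, and the coboundary of [edge_cochain] counts them
    face by face, even when both lie on one face. Equal sides give equal faces, and the sum is
    [0]. *)
Lemma B2_adjacent_faces f f' (i : 'I_(size (sides f))) (i' : 'I_(size (sides f'))) :
  (side i).1 = (side i').1 -> face_flux f + face_flux f' \in B2 K.
Proof.
move=> ii; have [ss|ss] := eqVneq (existT _ f i : sideT) (existT _ f' i').
  by have -> : f = f' := congr1 tag ss; rewrite flux_addrr rpred0.
pose e := (side i).1.
suff -> : face_flux f + face_flux f' = delta (edge_cochain e) by exact: B2_delta.
have es : edge_sides e = [set (existT _ f i : sideT); existT _ f' i'].
  apply/esym/eqP; rewrite eqEcard card_edge_sides cards2 ss /= andbT.
  by apply/fintype.subsetP => s; rewrite !inE => /orP[]/eqP -> /=; apply/eqP.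
apply/ffunP => g; rewrite deltaE !ffunE.
transitivity (\sum_(s : sideT | s \in edge_sides e) (tag s == g)%:R : 'Z_2).
  by rewrite es big_setU1 ?inE//= big_set1 eq_sym [f' == g]eq_sym.
rewrite (eq_bigr (fun j : 'I_(size (sides g)) => ((side j).1 == e)%:R)); last first.
  by move=> j _; rewrite ffunE.
transitivity (\sum_(f | f == g) \sum_(j < size (sides f)) ((side j).1 == e)%:R : 'Z_2).
  rewrite (sig_big_dep (fun f => f == g) (fun _ _ => true) (fun f (j : 'I_(size (sides f))) => ((side j).1 == e)%:R)).
  rewrite big_mkcond [RHS]big_mkcond; apply: eq_bigr => s _; rewrite inE andbT.
  by case: eqP; case: eqP.
by rewrite big_pred1_eq.
Qed.

Lemma faces_nonempty : exists f : face K, True.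
Proof.
have [[x _] _] := connX.
by have [f _] := face_cover (K := K) hX lpX x; exists f.
Qed.

Lemma B2_two_faces f f' : face_flux f + face_flux f' \in B2 K.
Proof.
have conX : connected [set: X]%classic by case: connX.
apply: (@dual_connected R X K hX lpX conX
  (fun f' => face_flux f + face_flux f' \in B2 K)).
- move=> g g' i i' Bg ii; have := rpredD Bg (B2_adjacent_faces ii).
  by rewrite addrA -(addrA (face_flux f)) flux_addrr addr0.
- by exists f; rewrite /= flux_addrr rpred0.
Qed.

(** An even [mu] does not change when a fixed face [f0] is added once per face of its support; this
    writes it as a sum of pairs of faces, each a coboundary by connectivity. *)
Lemma B2_parity mu : (mu \in B2 K) = (total_parity mu == 0).
Proof.
apply/idP/eqP => [/existsP[A /eqP <-]|mu0]; first exact: total_parity_delta.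
have [f0 _] := faces_nonempty.
suff -> : mu = \sum_f (face_flux f + face_flux f0) *+ nat_of_ord (mu f).
  by apply: rpred_sum => f _; apply: rpredMn; exact: B2_two_faces.
under eq_bigr do rewrite mulrnDl.
rewrite big_split /= -flux_sum -[LHS]addr0; congr (_ + _).
rewrite sumrMnr Z2_mulrn_parity ?flux_addrr// natr_sum -[RHS]mu0.
by apply: eq_bigr => f _; rewrite natr_Zp.
Qed.

Lemma edge_cochain_sum A : A = \sum_(e | A e == 1) edge_cochain e.
Proof.
apply/ffunP => e; rewrite sum_ffunE big_mkcond (bigD1 e)//= big1 ?addr0 => [|e' ee].
  by rewrite ffunE eqxx; case: (Z2_cases (A e)) => ->.
by case: ifP => // _; rewrite ffunE eq_sym (negbTE ee).
Qed.

(** The edges in the support of [A] are toggled one after the other. *)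
Lemma reachable_delta mu A : reachable K mu (mu + delta A).
Proof.
rewrite [A]edge_cochain_sum; apply: (big_ind (fun A => forall mu, reachable K mu (mu + delta A))).
- move=> nu; suff -> : delta (0 : cochain1 K) = 0 by rewrite addr0; exact: connect0.
  by rewrite -[0 in LHS](subrr 0) deltaB subrr.
- move=> A1 A2 h1 h2 nu; rewrite deltaD addrA; exact: connect_trans (h1 _) (h2 _).
- by move=> e _ nu; apply: connect1; apply/existsP; exists e.
Qed.

(** A toggle adds a coboundary, of parity [0]; conversely a difference of parity [0] is a
    coboundary, realised by toggles. *)
Lemma reachable_parity mu nu :
  reachable K mu nu = (total_parity mu == total_parity nu).
Proof.
apply/idP/idP => [/connectP[p]|].
  elim: p mu => [mu _ -> //|rho p IH mu /= /andP[/existsP[e /eqP ->] pth] lE].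
  rewrite -(eqP (IH _ pth lE)) /edge_toggle -[delta _]opprK total_parityB.
  by rewrite flux_oppr total_parity_delta subr0.
move=> /eqP mn; have : nu - mu \in B2 K by rewrite B2_parity total_parityB mn subrr.
move=> /existsP[A /eqP dA]; have := reachable_delta mu A.
by rewrite dA addrC subrK.
Qed.

Lemma cohomology_class_eq mu nu :
  (cohomology_class mu == cohomology_class nu) = (total_parity mu == total_parity nu).
Proof.
rewrite /cohomology_class -(Quotient.idealrBE (B2 K)) B2_parity total_parityB.
by rewrite subr_eq0.
Qed.

Lemma cohomology_class0 : cohomology_class (0 : flux K) = 0.
Proof. by rewrite /cohomology_class raddf0. Qed.

End Fluxes.

Theorem mainTheorem6 (R : realType) (X : topologicalType)
    (surfX : closed_surface R X) (connX : connected_space X)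
    (K : cellulation R X) :
  (* (1) *)
  [/\ exists ev : {additive H2 K -> 'Z_2},
        bijective ev /\
        forall mu : flux K, ev (cohomology_class mu) = total_parity mu,
      forall mu : flux K,
        (exists A, potential mu A) <-> cohomology_class mu = 0
    & forall mu : flux K, cohomology_class mu = 0 <-> total_parity mu = 0]
  /\
  (* (2) *)
  [/\ forall mu : flux K,
        [set nu | reachable K mu nu] = [set mu + b | b in B2 K],
      equivalence_rel (reachable K) /\
        finset.partition (sectors K) [set: flux K],
      #|sectors K| = #|{: H2 K}| /\ #|{: H2 K}| = 2%N,
      sectors K = [set even_fluxes K; odd_fluxes K]
    & (forall mu nu : flux K,
         total_parity mu = total_parity nu -> reachable K mu nu) /\
      (forall mu nu : flux K,
         mu \in even_fluxes K -> nu \in odd_fluxes K ->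
         ~~ reachable K mu nu /\ ~~ reachable K nu mu)].
Proof.
have [f0 _] := faces_nonempty K surfX connX.
have cls (mu nu : flux K) : (cohomology_class mu == cohomology_class nu) =
    (total_parity mu == total_parity nu) by exact: cohomology_class_eq.
have parity0 : total_parity (0 : flux K) = 0.
  by rewrite /total_parity big1// => f _; rewrite ffunE.
have cls0 (mu : flux K) : cohomology_class mu = 0 <-> total_parity mu = 0.
  rewrite -(cohomology_class0 K) -[X in _ <-> _ = X]parity0.
  by split=> /eqP h; apply/eqP; move: h; rewrite cls.
have reach (mu nu : flux K) : reachable K mu nu = (total_parity mu == total_parity nu).
  exact: reachable_parity.
(* Evaluation on chosen representatives, independent of the choice by [cls]. *)
pose ev (q : H2 K) : 'Z_2 := total_parity (repr q : flux K).
have evE (mu : flux K) : ev (cohomology_class mu) = total_parity mu.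
  by apply/eqP; rewrite -cls /cohomology_class reprK.
have classK (q : H2 K) : cohomology_class (repr q : flux K) = q by exact: reprK.
have ev_additive : zmod_morphism ev.
  move=> p q; rewrite -[p]classK -[q]classK -raddfB.
  by rewrite -/(cohomology_class _) !evE total_parityB.
have parity_face (z : 'Z_2) : exists mu : flux K, total_parity mu = z.
  case: (Z2_cases z) => ->; first by exists 0.
  by exists (face_flux f0); exact: total_parity_face_flux.
have ev_inj : injective ev.
  move=> p q; rewrite -[p]classK -[q]classK !evE => /eqP.
  by rewrite -cls => /eqP.
(* The zero flux and the flux of a single face represent the two classes; the face [f0] exists
   because [X] is nonempty. *)
pose lft (z : 'Z_2) : H2 K := cohomology_class (if z == 0 then 0 else face_flux f0).
have lftK : cancel lft ev.
  move=> z; rewrite /lft evE; case: (Z2_cases z) => -> /=; first exact: parity0.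
  exact: total_parity_face_flux.
have ev_bij : bijective ev by exists lft => //; exact: inj_can_sym lftK ev_inj.
pose evm := GRing.isZmodMorphism.Build _ _ ev ev_additive.
pose eva : {additive H2 K -> 'Z_2} := HB.pack ev evm.
have equivR : equivalence_rel (reachable K).
  by move=> mu nu rho; rewrite !reach; split=> // /eqP ->.
have sectorsE : sectors K = [set even_fluxes K; odd_fluxes K].
  apply/setP => S; rewrite !inE; apply/imsetP/orP => [[mu _ ->]|].
    case: (Z2_cases (total_parity mu)) => muE; [left|right]; apply/eqP/setP => nu;
      by rewrite !inE reach muE eq_sym.
  move=> [] /eqP ->; [have [mu muE] := parity_face 0|have [mu muE] := parity_face 1];
    exists mu => //; apply/setP => nu; by rewrite !inE reach muE eq_sym.
have cardH : #|{: H2 K}| = 2 by rewrite (bij_eq_card ev_bij) card_ord.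
split; split.
- by exists eva; split.
- move=> mu; rewrite cls0; split=> [[A dA]|/eqP mu0].
    by rewrite -dA total_parity_delta.
  by move: mu0; rewrite -B2_parity// => /existsP[A /eqP dA]; exists A.
- exact: cls0.
- move=> mu; apply/setP => nu; rewrite inE reach; apply/eqP/imsetP => [mn|[b + ->]].
    exists (nu - mu); last by rewrite addrC subrK.
    by rewrite B2_parity// total_parityB mn subrr.
  rewrite B2_parity// => /eqP b0.
  by rewrite -(flux_oppr b) total_parityB b0 subr0.
- by split=> //; apply: equivalence_partitionP => mu nu rho _ _ _; exact: equivR.
- split=> //; rewrite cardH sectorsE cards2.
  have [mu muE] := parity_face 0; suff -> : even_fluxes K != odd_fluxes K by [].
  by apply/eqP => /setP/(_ mu); rewrite !inE muE.
- exact: sectorsE.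
- split=> [mu nu mn|mu nu]; first by rewrite reach mn.
  by rewrite !inE => /eqP mE /eqP nE; rewrite !reach mE nE.
Qed.
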